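(* Let $\Omega$ be a locally quasiconvex, locally Ahlfors $Q$-regular abstract domain with a Gromov hyperbolic quasihyperbolization, i.e. such that $(\Omega,k)$ is Gromov hyperbolic, where $k$ is the quasihyperbolic metric of $\Omega$. Then the Gromov boundary of $(\Omega,k)$ equipped with any Bourdon metric or any Hamenstädt metric is doubling. (A Bourdon metric is a metric $d_{w,\varepsilon}$ on $\partial_\infty\Omega$, and a Hamenstädt metric is a metric $\sigma_{b,\varepsilon}$ on a punctured boundary $\partial_\infty\Omega\setminus\{\xi\}$ with $\xi\in\partial_\infty\Omega$, as defined in the context with $X=(\Omega,k)$.)
   Context: An abstract domain is a locally compact, rectifiably connected, incomplete metric space $(\Omega,d)$. Write $\partial\Omega=\overline\Omega\setminus\Omega\neq\emptyset$ with $\overline\Omega$ the metric completion, and $d_\Omega(x)=\operatorname{dist}(x,\partial\Omega)$. $(\Omega,d)$ is locally quasiconvex if for some $c\ge1$ and $0<\lambda\le1/2$, for every $x\in\Omega$ each pair of points $u,v$ in $B(x,\lambda d_\Omega(x))$ can be joined by a curve of length at most $c\,d(u,v)$. It is locally Ahlfors $Q$-regular ($Q>0$) if it carries a Borel measure $\mu$ for which there are $C\ge1$ and $0<\lambda\le 1/2$ with $C^{-1}r^Q\le\mu(B(x,r))\le Cr^Q$ for all $x\in\Omega$ and $0<r\le\lambda d_\Omega(x)$. The quasihyperbolic metric is $k(x,y)=\inf\int_\gamma\frac{|dz|}{d_\Omega(z)}$, the infimum over rectifiable curves $\gamma$ in $\Omega$ joining $x$ and $y$ (arc-length integral). A metric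 space is doubling if there is a constant $C$ such that every metric ball $B$ can be covered by at most $C$ balls of half the radius of $B$. Gromov hyperbolicity: for a metric space $(X,\mathbf d)$ the Gromov product is $(x|y)_w=\frac12[\mathbf d(x,w)+\mathbf d(y,w)-\mathbf d(x,y)]$. $X$ is Gromov ($\delta$-)hyperbolic if for some $\delta\ge 0$, $(x|y)_w\ge\min\{(x|z)_w,(z|y)_w\}-\delta$ for all $x,y,z,w\in X$. Gromov boundary: a sequence $\{x_i\}$ in $X$ is a Gromov sequence if $(x_i|x_j)_w\to\infty$ as $i,j\to\infty$; two Gromov sequences $\{x_i\},\{y_i\}$ are equivalent if $(x_i|y_i)_w\to\infty$; $\partial_\infty X$ is the set of equivalence classes; $\partial_\infty\Omega$ denotes $\partial_\infty X$ for $X=(\Omega,k)$. For $a\in X$ and $\eta,\xi\in\partial_\infty X$, $(a|\eta)_w=\inf\{\liminf_{i}(a|b_i)_w:\{b_i\}\in\eta\}$ and $(\xi|\eta)_w=\inf\{\liminf_i(a_i|b_i)_w:\{a_i\}\in\xi,\{b_i\}\in\eta\}$. Bourdon metric: for $w\in X$ and $0<\varepsilon<\min\{1,\frac1{5\delta}\}$ put $\rho_{w,\varepsilon}(\xi,\zeta)=e^{-\varepsilon(\xi|\zeta)_w}$ (with $e^{-\infty}=0$) on $\partial_\infty X$, and $d_{w,\varepsilon}(\xi,\zeta)=\inf\sum_{i=1}^n\rho_{w,\varepsilon}(\xi_{i-1},\xi_i)$, the infimum over all $n\ge1$ and finite chains $\xi=\xi_0,\dots,\xi_n=\zeta$ in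 $\partial_\infty X$. Then $d_{w,\varepsilon}$ is a metric with $\rho_{w,\varepsilon}/2\le d_{w,\varepsilon}\le\rho_{w,\varepsilon}$, called the Bourdon metric based at $w$ with parameter $\varepsilon$. Hamenstädt metric: for $\xi\in\partial_\infty X$ and $w\in X$, the Busemann function based at $\xi$ is $b(x)=b_{\xi,w}(x)=(\xi|w)_x-(\xi|x)_w$, $x\in X$. Put $(x|y)_b=\frac12(b(x)+b(y)-\mathbf d(x,y))$ for $x,y\in X$, and $(\xi_1|\xi_2)_b=\inf\{\liminf_i(x_i|y_i)_b:\{x_i\}\in\xi_1,\{y_i\}\in\xi_2\}$ for $\xi_1,\xi_2\in\partial_\infty X\setminus\{\xi\}$. For $\varepsilon>0$ with $e^{22\varepsilon\delta}\le2$, put $\rho_{b,\varepsilon}(\xi_1,\xi_2)=e^{-\varepsilon(\xi_1|\xi_2)_b}$ and $\sigma_{b,\varepsilon}(x,y)=\inf\sum_{i=1}^n\rho_{b,\varepsilon}(x_{i-1},x_i)$, the infimum over all $n\ge1$ and finite chains $x=x_0,\dots,x_n=y$ in $\partial_\infty X\setminus\{\xi\}$. Then $\sigma_{b,\varepsilon}$ is a metric on $\partial_\infty X\setminus\{\xi\}$ with $\rho_{b,\varepsilon}/2\le\sigma_{b,\varepsilon}\le\rho_{b,\varepsilon}$, called the Hamenstädt metric based at $\xi$ (or at $b$) with parameter $\varepsilon$. *)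

(* Defs.v *)
From HB Require Import structures.
From mathcomp Require Import all_boot all_order all_algebra.
From mathcomp Require Import all_classical all_reals all_analysis.
Set Implicit Arguments.
Unset Strict Implicit.
Unset Printing Implicit Defensive.
Import Order.TTheory GRing.Theory Num.Theory.
Import numFieldNormedType.Exports.
Local Open Scope classical_set_scope.
Local Open Scope ring_scope.

(* The library equips only pointed types with a generated sigma-algebra.
   A distinguished point is harmless here: an incomplete space is nonempty. *)
#[short(type="pointedMetricType")]
HB.structure Definition PointedMetric (K : numDomainType) :=
  {M of Metric K M & isPointed M}.

Section Completion.
Context {R : realType} {T : metricType R}.

Definition cauchy_seq (u : nat -> T) : Prop := cauchy (u @ \oo).

Definition cauchy_class (u : nat -> T) : set (nat -> T) :=
  [set v | cauchy_seq v /\ mdist (u n) (v n) @[n --> \oo] --> (0 : R)].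

Definition completion : set (set (nat -> T)) :=
  [set cauchy_class u | u in cauchy_seq].

Definition completion_embed (x : T) : set (nat -> T) :=
  cauchy_class (fun=> x).

(* The set below is the singleton of the common limit of d(u_n, v_n) over all
   representatives u of p and v of q. *)
Definition completion_dist (p q : set (nat -> T)) : R :=
  inf [set l | exists u v, [/\ p u, q v &
                              mdist (u n) (v n) @[n --> \oo] --> l]].

Definition metric_boundary : set (set (nat -> T)) :=
  completion `\` range completion_embed.

Definition boundary_dist (x : T) : R :=
  inf [set completion_dist (completion_embed x) p | p in metric_boundary].

End Completion.

Section Curves.
Context {R : realType} {T : metricType R}.
Implicit Types (g : R -> T) (a b : R).

(* The partition points a < s_0 < ... < b are listed by a :: s. *)
Definition polygonal_length a b g (s : seq R) : R :=
  let F := g \o nth b (a :: s) in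
  \sum_(0 <= n < size s) mdist (F n) (F n.+1).

Definition curve_length a b g : \bar R :=
  ereal_sup [set (polygonal_length a b g s)%:E | s in itv_partition a b].

Definition curve_joining (x y : T) a b g : Prop :=
  [/\ a <= b, {within `[a, b], continuous g}, g a = x & g b = y].

Definition rectifiable a b g : Prop := (curve_length a b g < +oo)%E.

(* g(t) for any t in [a, b] such that g restricted to [a, t] has length s;
   g(t) does not depend on the choice of t. *)
Definition arclength_param a b g (s : R) : T :=
  g (xget a [set t | a <= t <= b /\ curve_length a t g = s%:E]).

Definition line_integral (rho : T -> R) a b g : \bar R :=
  \int[lebesgue_measure]_(s in `[0, fine (curve_length a b g)])
    (rho (arclength_param a b g s))%:E.

End Curves.

Section AbstractDomains.
Context {R : realType}.

Definition rectifiably_connected (T : metricType R) : Prop :=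
  forall x y : T, exists a b g, curve_joining x y a b g /\ rectifiable a b g.

Definition incomplete (T : metricType R) : Prop :=
  ~ (forall u : nat -> T, cauchy_seq u -> exists l : T, u @ \oo --> l).

Definition abstract_domain (T : metricType R) : Prop :=
  [/\ locally_compact [set: T], rectifiably_connected T & incomplete T].

Definition locally_quasiconvex (T : metricType R) : Prop :=
  exists c lambda : R, [/\ 1 <= c, 0 < lambda <= 2^-1 &
    forall x u v : T,
      ball x (lambda * boundary_dist x) u ->
      ball x (lambda * boundary_dist x) v ->
      exists a b g, curve_joining u v a b g /\
        (curve_length a b g <= (c * mdist u v)%:E)%E].

Definition locally_ahlfors_regular (T : pointedMetricType R) (Q : R) : Prop :=
  exists mu : {measure set (g_sigma_algebraType (@open T)) -> \bar R},
  exists C lambda : R, [/\ 1 <= C, 0 < lambda <= 2^-1 &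
    forall (x : T) (r : R), 0 < r <= lambda * boundary_dist x ->
      ((C^-1 * r `^ Q)%:E <= mu (ball x r) <= (C * r `^ Q)%:E)%E].

(* The infimum is finite when T is an abstract domain. *)
Definition qhyp (T : metricType R) (x y : T) : R :=
  fine (ereal_inf [set l | exists a b g,
    [/\ curve_joining x y a b g, rectifiable a b g &
        l = line_integral (fun z => (boundary_dist z)^-1) a b g]]).

End AbstractDomains.

(* The centers c i may repeat, so this asks for at most C balls.  The ambient
   metric space is A with the restriction of d. *)
Definition doubling {R : realType} {P : Type} (A : set P) (d : P -> P -> R) :
    Prop :=
  exists C : nat, forall (x : P) (r : R), A x -> 0 < r ->
    exists c : 'I_C -> P, (forall i, A (c i)) /\
      (A `&` [set y | d x y < r]
         `<=` \bigcup_i [set y | d (c i) y < r / 2]).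

(* A chain is c 0, ..., c n; the values of c beyond n are irrelevant.
   For the functions rho below the infimum is finite. *)
Definition chain_dist {R : realType} {P : Type} (A : set P)
    (rho : P -> P -> \bar R) (x y : P) : R :=
  fine (ereal_inf [set l | exists (n : nat) (c : nat -> P),
    [/\ (0 < n)%N, (forall i, (i <= n)%N -> A (c i)), c 0%N = x, c n = y &
        l = (\sum_(0 <= i < n) rho (c i) (c i.+1))%E]]).

Section Gromov.
Context {R : realType} {X : Type} (d : X -> X -> R).

Definition gromov_product (w x y : X) : R :=
  2^-1 * (d x w + d y w - d x y).

Definition delta_hyperbolic (delta : R) : Prop :=
  0 <= delta /\ forall x y z w : X,
    Num.min (gromov_product w x z) (gromov_product w z y) - delta
      <= gromov_product w x y.

Definition gromov_hyperbolic : Prop := exists delta, delta_hyperbolic delta.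

(* Divergence of Gromov products does not depend on the base point. *)
Definition gromov_sequence (u : nat -> X) : Prop := forall w,
  gromov_product w (u ij.1) (u ij.2) @[ij --> (\oo, \oo)] --> +oo.

Definition gromov_equiv (u v : nat -> X) : Prop := forall w,
  gromov_product w (u n) (v n) @[n --> \oo] --> +oo.

Definition gromov_class (u : nat -> X) : set (nat -> X) :=
  [set v | gromov_sequence v /\ gromov_equiv u v].

Definition gromov_boundary : set (set (nat -> X)) :=
  [set gromov_class u | u in gromov_sequence].

Definition gromov_product_pt (w a : X) (eta : set (nat -> X)) : \bar R :=
  ereal_inf [set limn_einf (fun i => (gromov_product w a (v i))%:E)
            | v in eta].

Definition gromov_product_bd (w : X) (xi eta : set (nat -> X)) : \bar R :=
  ereal_inf [set limn_einf (fun i => (gromov_product w (u i) (v i))%:E)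
            | u in xi & v in eta].

Definition bourdon_rho (w : X) (eps : R) (xi zeta : set (nat -> X)) : \bar R :=
  expeR ((- eps)%:E * gromov_product_bd w xi zeta).

Definition bourdon_dist (w : X) (eps : R) :=
  chain_dist gromov_boundary (bourdon_rho w eps).

Definition busemann (xi : set (nat -> X)) (w x : X) : R :=
  fine (gromov_product_pt x w xi) - fine (gromov_product_pt w x xi).

Definition busemann_product (b : X -> R) (x y : X) : R :=
  2^-1 * (b x + b y - d x y).

Definition busemann_product_bd (b : X -> R) (xi eta : set (nat -> X)) :
    \bar R :=
  ereal_inf [set limn_einf (fun i => (busemann_product b (u i) (v i))%:E)
            | u in xi & v in eta].

Definition hamenstadt_rho (b : X -> R) (eps : R) (xi zeta : set (nat -> X)) :
    \bar R :=
  expeR ((- eps)%:E * busemann_product_bd b xi zeta).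

Definition punctured_boundary (xi : set (nat -> X)) : set (set (nat -> X)) :=
  gromov_boundary `\ xi.

Definition hamenstadt_dist (xi : set (nat -> X)) (w : X) (eps : R) :=
  chain_dist (punctured_boundary xi) (hamenstadt_rho (busemann xi w) eps).

End Gromov.

(* eps < 1 / (5 delta) is written multiplicatively because its right-hand side
   means +oo, not 0, when delta = 0. *)
Definition bourdon_parameter {R : realType} (delta eps : R) : Prop :=
  [/\ 0 < eps, eps < 1 & eps * (5 * delta) < 1].

Definition hamenstadt_parameter {R : realType} (delta eps : R) : Prop :=
  0 < eps /\ expR (22 * eps * delta) <= 2.

(* Main.v *)
Require Import Defs.
From mathcomp Require Import all_boot all_order all_algebra.
From mathcomp Require Import all_classical all_reals all_analysis.
From mathcomp Require Import ring lra.
Import Order.TTheory GRing.Theory Num.Theory.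
Import numFieldNormedType.Exports.
Set Implicit Arguments.
Unset Strict Implicit.
Unset Printing Implicit Defensive.
Local Open Scope classical_set_scope.
Local Open Scope ring_scope.

(** The proof has three independent parts.

    Boundary points are represented by sequences, and both metrics are
    comparable with [exp (- eps * p)], where [p] is the lower limit of a product
    of representatives: the Gromov product based at [w], or the product of a
    Busemann function.  Both products satisfy the hyperbolicity inequality on
    points, with defect [delta] and [3 * delta], so the range of [eps] makes the
    chain infimum at least half of the exponential.  A ball of the boundary
    metric then consists of points whose pairwise products are at least some
    [t], and points separated at half the radius have products at most [t + D]
    with [D] independent of the ball.  Doubling is therefore a packing statement:
    among sufficiently many points with pairwise products at least [t], two have
    product at least [t + D] ([boundary_doubling]).

    In a hyperbolic space with approximate intermediate points this follows from
    a bound, for each radius, on the number of pairwise separated points in a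
    ball of that radius: the points at distance [t + M] from the base point on
    approximate geodesics to the given far away points all lie in one ball of
    radius depending on [M] only, and two that nearly coincide belong to
    geodesics that stay together up to time [t + M]
    ([gromov_product_packing]).  The bound is uniform in the base point.  It
    applies to a Busemann product as well, because that product is, up to
    bounded error and an additive constant, a Gromov product based at a point far
    out in a sequence converging to [xi] ([busemann_product_approx]).

    For the quasihyperbolic metric [k], arc length turns every rectifiable curve
    into a 1-Lipschitz path with the same line integral, while the integral along
    any 1-Lipschitz path is at least [k] of its ends ([qhyp_le_segint],
    [qhyp_path]).  Hence [k] is a length pseudometric: paths can be reversed,
    concatenated, and cut where the integral has a prescribed value.  A small
    [k]-ball about [z] lies well inside the metric ball of radius comparable to
    the distance from [z] to the boundary.  There quasiconvexity makes
    [k]-separated points metrically separated, and Ahlfors regularity bounds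
    their number ([qhyp_packing_small]).  Regularity says nothing about larger
    balls, so the bound for all radii is obtained by enlarging the radius in
    small steps with intermediate points ([ball_covering]). *)

(** * Chain metrics and nets *)

Section Chains.
Context {R : realType} {P : Type}.
Implicit Types (A : set P).

(** Frink's argument.  Cutting a chain at the link that straddles half of its
    length leaves two shorter chains, each of at most half the length, so by
    induction their ends, like those of the link itself, are at [rho]-distance
    at most the total length.  Joining the three pieces costs [K ^+ 2 <= 2]. *)
Lemma quasi_ultrametric_chain A (rho : P -> P -> R) (K : R) (c : nat -> P)
    (n : nat) :
  1 <= K -> K ^+ 2 <= 2 -> (forall x y, 0 <= rho x y) ->
  (forall x y z, A x -> A y -> A z ->
     rho x z <= K * Num.max (rho x y) (rho y z)) ->
  (forall i, (i <= n)%N -> A (c i)) -> (0 < n)%N ->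
  rho (c 0%N) (c n) <= 2 * \sum_(0 <= i < n) rho (c i) (c i.+1).
Proof.
move=> K1 K2 rho0 tri Ac.
pose S m p := \sum_(m <= i < p) rho (c i) (c i.+1).
have S0 m p : 0 <= S m p by apply: sumr_ge0.
suff main : forall k m p, (p - m <= k)%N -> (m < p <= n)%N ->
    rho (c m) (c p) <= 2 * S m p.
  by move=> n0; apply: (main n) => //; rewrite ?subn0 // n0 leqnn.
elim=> [|k IH] m p.
  by rewrite leqn0 subn_eq0 => pm /andP[]; rewrite ltnNge pm.
move=> pmk /andP[mp pn].
(* the link after the last cut with at most half of the total on its left
   straddles the midpoint *)
pose cut q := [&& (m <= q)%N, (q < p)%N & S m q <= S m p / 2].
have cutm : exists q, cut q.
  exists m; rewrite /cut leqnn mp /= [S m m]/S big_geq //.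
  by apply: divr_ge0 => //; exact: S0.
have cutb q : cut q -> (q <= p)%N by case/and3P => _ /ltnW.
case: (ex_maxnP cutm cutb) => q /and3P[mq qp Sq] qmax.
have Scat a b d : (a <= b)%N -> (b <= d)%N -> S a d = S a b + S b d.
  by move=> ab bd; rewrite /S (big_cat_nat ab bd).
have Ssing : S q q.+1 = rho (c q) (c q.+1) by rewrite /S big_nat1.
have Stot : S m p = S m q + rho (c q) (c q.+1) + S q.+1 p.
  by rewrite (Scat m q p mq (ltnW qp)) (Scat q q.+1 p (leqnSn q) qp) Ssing addrA.
have S1 := S0 m q; have S2 := S0 q.+1 p; have S3 := rho0 (c q) (c q.+1).
have Sr : (q.+1 < p)%N -> S q.+1 p <= S m p / 2.
  move=> q1p; case: (leP (S m q.+1) (S m p / 2)) => h.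
    have : cut q.+1 by rewrite /cut q1p h (leq_trans mq).
    by move/qmax; rewrite ltnn.
  by move: h; rewrite (Scat m q q.+1 mq (leqnSn q)) Ssing; lra.
have Am : A (c m) by apply: Ac; rewrite (leq_trans (ltnW mp)).
have Ap : A (c p) by apply: Ac.
have Aq : A (c q) by apply: Ac; rewrite (leq_trans (ltnW qp)).
have Aq1 : A (c q.+1) by apply: Ac; rewrite (leq_trans qp).
set T := S m p in Sq Stot Sr *.
have T0 : 0 <= T by apply: S0.
have right_part : rho (c q) (c p) <= K * T.
  move: qp; rewrite leq_eqVlt => /orP[/eqP q1p|q1p].
    by rewrite -q1p; nra.
  apply: (le_trans (tri _ (c q.+1) _ Aq Aq1 Ap)).
  apply: ler_wpM2l; first lra.
  rewrite ge_max; apply/andP; split; first lra.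
  have : rho (c q.+1) (c p) <= 2 * S q.+1 p.
    apply: IH; last by rewrite q1p.
    by rewrite -ltnS (leq_trans _ pmk)// ltn_sub2l// ltnS.
  by have := Sr q1p; lra.
move: mq; rewrite leq_eqVlt => /orP[/eqP mq|mq].
  by rewrite mq; apply: (le_trans right_part); nra.
apply: (le_trans (tri _ (c q) _ Am Aq Ap)).
apply: (@le_trans _ _ (K * (K * T))); last by nra.
apply: ler_wpM2l; first lra.
rewrite ge_max right_part andbT.
have : rho (c m) (c q) <= 2 * S m q.
  apply: IH; last by rewrite mq (leq_trans (ltnW qp)).
  by rewrite -ltnS (leq_trans _ pmk)// ltn_sub2r.
by nra.
Qed.

Section ChainDist.
Variables (A : set P) (rho : P -> P -> \bar R).
Hypothesis rho_fin : forall x y, A x -> A y -> rho x y \is a fin_num.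
Hypothesis rho_ge0 : forall x y, (0%:E <= rho x y)%E.

Let chains x y := [set l | exists (n : nat) (c : nat -> P),
    [/\ (0 < n)%N, (forall i, (i <= n)%N -> A (c i)), c 0%N = x, c n = y &
        l = (\sum_(0 <= i < n) rho (c i) (c i.+1))%E]].

Lemma chain_dist_le x y : A x -> A y ->
  chain_dist A rho x y <= fine (rho x y).
Proof.
move=> Ax Ay; rewrite /chain_dist -/(chains x y).
have le1 : (ereal_inf (chains x y) <= rho x y)%E.
  apply: ereal_inf_lbound; exists 1%N, (fun i => if i is 0%N then x else y).
  by split => //; [case=> // | rewrite big_nat1].
apply: fine_le => //; last exact: rho_fin.
rewrite ge0_fin_numE; last first.
  by apply: le_ereal_inf_tmp => _ [n [c [_ _ _ _ ->]]]; apply: sume_ge0.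
by rewrite (le_lt_trans le1)// ltey_eq rho_fin.
Qed.

Lemma chain_dist_ge (K : R) x y : 1 <= K -> K ^+ 2 <= 2 ->
  (forall x y z, A x -> A y -> A z -> fine (rho x z) <=
     K * Num.max (fine (rho x y)) (fine (rho y z))) ->
  A x -> A y -> fine (rho x y) <= 2 * chain_dist A rho x y.
Proof.
move=> K1 K2 tri Ax Ay; rewrite /chain_dist -/(chains x y).
have le1 : ((fine (rho x y) / 2)%:E <= ereal_inf (chains x y))%E.
  apply: le_ereal_inf_tmp => _ [n [c [n0 Ac cx cy ->]]].
  have -> : (\sum_(0 <= i < n) rho (c i) (c i.+1))%E =
      (\sum_(0 <= i < n) fine (rho (c i) (c i.+1)))%:E.
    rewrite -sumEFin !big_nat; apply: eq_bigr => i /andP[_ ilt].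
    by rewrite fineK// rho_fin//; apply: Ac => //; exact: ltnW.
  rewrite lee_fin ler_pdivrMr// mulrC -cx -cy.
  by apply: (quasi_ultrametric_chain (rho := fun x y => fine (rho x y)) K1 K2
    _ tri) => // a b; exact: fine_ge0.
have : ereal_inf (chains x y) != +oo%E.
  rewrite -ltey; apply: (@le_lt_trans _ _ (rho x y)); last first.
    by rewrite ltey_eq rho_fin.
  apply: ereal_inf_lbound; exists 1%N, (fun i => if i is 0%N then x else y).
  by split => //; [case=> // | rewrite big_nat1].
move: le1; case: ereal_inf => [s| |]//=.
by rewrite lee_fin; lra.
Qed.

End ChainDist.

(** A maximal family of pairwise non-close points is a net. *)
Lemma greedy_cover (S : set P) (close : P -> P -> Prop) (N : nat) (x : P) :
  S x ->
  (forall y : nat -> P, (forall i, (i < N)%N -> S (y i)) ->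
    exists i j, (i < j < N)%N /\ close (y i) (y j)) ->
  exists c : nat -> P, (forall i, S (c i)) /\
    forall z, S z -> exists2 i, (i < N)%N & close (c i) z.
Proof.
move=> Sx pack.
pose sep n := exists y : nat -> P, (forall i, (i < n)%N -> S (y i)) /\
  (forall i j, (i < j < n)%N -> ~ close (y i) (y j)).
have nsepN : ~ sep N.
  by move=> [y [yS ys]]; have [i [j [ij]]] := pack y yS; exact: ys.
have [n [nN [y [yS ys]] nsep]] : exists n, [/\ (n < N)%N, sep n & ~ sep n.+1].
  apply: contrapT => nex; apply: nsepN.
  suff : forall n, (n <= N)%N -> sep n by apply.
  elim=> [_|n IH nN]; first by exists (fun=> x); split=> [//|i j]; rewrite andbF.
  apply: contrapT => ns; apply: nex; exists n; split => //.
  exact/IH/ltnW.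
exists (fun i => if (i < n)%N then y i else x); split.
  by move=> i; case: ifP => // /yS.
move=> z Sz; apply: contrapT => nz; apply: nsep.
exists (fun i => if (i < n)%N then y i else z); split.
  by move=> i _; case: ifP => [/yS|].
move=> i j /andP[ij]; rewrite ltnS leq_eqVlt => /orP[/eqP jn|jn]; last first.
  by rewrite jn (ltn_trans ij jn); apply: ys; rewrite ij.
rewrite jn ltnn -jn ij => close_iz; apply: nz.
by exists i; [apply: ltn_trans nN; rewrite -jn|rewrite -jn ij].
Qed.

Lemma doubling_of_packing A (d : P -> P -> R) (N : nat) :
  (forall x r (y : nat -> P), A x -> 0 < r ->
    (forall i, (i < N)%N -> A (y i) /\ d x (y i) < r) ->
    exists i j, (i < j < N)%N /\ d (y i) (y j) < r / 2) ->
  doubling A d.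
Proof.
move=> pack; exists N => x r Ax r0.
case: (pselect (exists x0, A x0 /\ d x x0 < r)) => [[x0 Sx0]|noS]; last first.
  by exists (fun=> x); split => // z Sz; case: noS; exists z.
have [c [cS cN]] := greedy_cover (S := [set y | A y /\ d x y < r])
  (close := fun y z => d y z < r / 2) Sx0
  (fun y => pack x r y Ax r0).
exists (fun i : 'I_N => c i); split=> [i|z Sz]; first by case: (cS i).
by have [i iN ci] := cN z Sz; exists (Ordinal iN).
Qed.

End Chains.

Section Liminf.
Context {R : realType}.
Implicit Types (a : nat -> R) (t : R).

Lemma limn_einf_gtP a t : (t%:E < limn_einf (fun n => (a n)%:E))%E ->
  \forall n \near \oo, t <= a n.
Proof.
rewrite limn_einf_lim (cvg_lim _ (@cvg_einfs_sup _ _))//.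
move=> /ereal_sup_gt[_ [N _ <-]] tN; exists N => // n /= Nn.
rewrite -lee_fin ltW// (lt_le_trans tN)//.
by apply: ereal_inf_lbound; exists n.
Qed.

Lemma limn_einf_geP a t : (\forall n \near \oo, t <= a n) ->
  (t%:E <= limn_einf (fun n => (a n)%:E))%E.
Proof.
move=> [N _ Nt]; rewrite limn_einf_lim (cvg_lim _ (@cvg_einfs_sup _ _))//.
apply: (@le_trans _ _ (einfs (fun n => (a n)%:E) N)); last first.
  by apply: ereal_sup_ubound; exists N.
by apply: le_ereal_inf_tmp => _ [n /= Nn <-]; rewrite lee_fin; exact: Nt.
Qed.

Lemma near_lt_all (P : nat -> nat -> Prop) (N : nat) :
  (forall i, (i < N)%N -> \forall m \near \oo, P i m) ->
  \forall m \near \oo, forall i, (i < N)%N -> P i m.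
Proof.
elim: N => [_|N IH h]; first by near=> m.
have h1 : \forall m \near \oo, P N m by apply: h.
have h2 : \forall m \near \oo, forall i, (i < N)%N -> P i m.
  by apply: IH => i iN; apply: h; exact: ltnW.
near=> m; move=> i; rewrite ltnS leq_eqVlt => /orP[/eqP->|iN].
  by near: m.
by move: i iN; near: m.
Unshelve. all: by end_near. Qed.

Lemma near_lt_pairs (Q : nat -> nat -> nat -> Prop) (N : nat) :
  (forall i j, (i < j < N)%N -> \forall m \near \oo, Q i j m) ->
  \forall m \near \oo, forall i j, (i < j < N)%N -> Q i j m.
Proof.
move=> h; suff : \forall m \near \oo, forall j, (j < N)%N ->
    forall i, (i < j)%N -> Q i j m.
  by apply: filterS => m hm i j /andP[ij jN]; exact: hm.
apply: near_lt_all => j jN; apply: near_lt_all => i ij.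
by apply: h; rewrite ij.
Qed.

End Liminf.

(** * Doubling from packing of representatives *)

Section BoundaryProduct.
Context {R : realType} {X : Type}.
Variables (P : X -> X -> R) (dl : R) (A : set (set (nat -> X))).

(** The common form of the Gromov product and of the Busemann product of two
    boundary points; [P] is the product of points and [dl] its defect. *)
Definition boundary_product (xi eta : set (nat -> X)) : \bar R :=
  ereal_inf [set limn_einf (fun i => (P (u i) (v i))%:E)
            | u in xi & v in eta].

Hypothesis dl_ge0 : 0 <= dl.
Hypothesis Psym : forall x y, P x y = P y x.
Hypothesis Pultra : forall x y z, Num.min (P x z) (P z y) - dl <= P x y.
Hypothesis A_neq0 : forall xi, A xi -> exists u, xi u.
Hypothesis P_same : forall xi u v, A xi -> xi u -> xi v ->
  forall B, exists N, forall n m, (N <= n)%N -> (N <= m)%N -> B <= P (u n) (v m).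
Hypothesis P_bounded : forall xi eta, A xi -> A eta ->
  exists u v B, [/\ xi u, eta v & \forall n \near \oo, B <= P (u n) (v n)].

Let Pultra_le t x y z : t <= P x z -> t <= P z y -> t - dl <= P x y.
Proof.
move=> xz zy; apply: le_trans (Pultra x y z); rewrite lerD2r.
by rewrite le_min xz zy.
Qed.

Let Pultra2_le t x y z w : t <= P x z -> t <= P z w -> t <= P w y ->
  t - 2 * dl <= P x y.
Proof.
move=> xz zw wy; have zy := Pultra_le zw wy.
have : t - dl <= P x z by have := dl_ge0; lra.
by move/Pultra_le => /(_ _ zy); lra.
Qed.

Lemma boundary_product_lt xi eta t u v : xi u -> eta v ->
  (t%:E < boundary_product xi eta)%E ->
  \forall n \near \oo, t <= P (u n) (v n).
Proof.
move=> xiu etav tP; apply: (limn_einf_gtP (a := fun n => P (u n) (v n))).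
by apply: (lt_le_trans tP); apply: ereal_inf_lbound; exists u => //; exists v.
Qed.

Lemma boundary_product_ge xi eta t :
  (forall u v, xi u -> eta v -> \forall n \near \oo, t <= P (u n) (v n)) ->
  (t%:E <= boundary_product xi eta)%E.
Proof.
move=> h; apply: le_ereal_inf_tmp => _ [u xiu [v etav <-]].
by apply: limn_einf_geP; exact: h.
Qed.

(** Replacing both sequences by equivalent ones costs at most twice the
    ultrametric defect, so a bound that one pair of representatives satisfies
    infinitely often holds for every pair, eventually. *)
Lemma boundary_product_gt xi eta t u v : A xi -> A eta -> xi u -> eta v ->
  (boundary_product xi eta < t%:E)%E ->
  \forall n \near \oo, P (u n) (v n) <= t + 2 * dl.
Proof.
move=> Axi Aeta xiu etav /ereal_inf_lt[_ [u' xiu' [v' etav' <-]]] lt_t.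
have [N1 h1] := P_same Axi xiu' xiu (t + 2 * dl).
have [N2 h2] := P_same Aeta etav etav' (t + 2 * dl).
exists (maxn N1 N2) => // n /=; rewrite geq_max => /andP[n1 n2].
rewrite leNgt; apply/negP => Pn.
have : (t%:E <= limn_einf (fun i => (P (u' i) (v' i))%:E))%E.
  apply: limn_einf_geP; exists (maxn N1 N2) => // m /=.
  rewrite geq_max => /andP[m1 m2].
  have -> : t = t + 2 * dl - 2 * dl by ring.
  by apply: (Pultra2_le (h1 _ _ m1 n1) (ltW Pn) (h2 _ _ n2 m2)).
by rewrite leNgt lt_t.
Qed.

Lemma boundary_product_gtNy xi eta : A xi -> A eta ->
  (-oo < boundary_product xi eta)%E.
Proof.
move=> Axi Aeta; have [u [v [B [xiu etav [N _ hB]]]]] := P_bounded Axi Aeta.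
apply: (@lt_le_trans _ _ (B - 2 * dl)%:E); first exact: ltNyr.
apply: boundary_product_ge => u' v' xiu' etav'.
have [N1 h1] := P_same Axi xiu' xiu B.
have [N2 h2] := P_same Aeta etav etav' B.
exists (maxn N (maxn N1 N2)) => // n /=; rewrite !geq_max => /and3P[n0 n1 n2].
exact: (Pultra2_le (h1 _ _ n1 n1) (hB _ n0) (h2 _ _ n2 n2)).
Qed.

Lemma boundary_product_ultra xi eta zeta t : A eta ->
  (t%:E < boundary_product xi eta)%E -> (t%:E < boundary_product eta zeta)%E ->
  ((t - dl)%:E <= boundary_product xi zeta)%E.
Proof.
move=> Aeta xe ez; have [w etaw] := A_neq0 Aeta.
apply: boundary_product_ge => u v xiu zetav.
have := boundary_product_lt xiu etaw xe.
have := boundary_product_lt etaw zetav ez.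
by apply: filterS2 => n wv uw; exact: Pultra_le uw wv.
Qed.

Section Rho.
Variable eps : R.
Hypothesis eps_gt0 : 0 < eps.

Definition boundary_rho (xi eta : set (nat -> X)) : \bar R :=
  expeR ((- eps)%:E * boundary_product xi eta).

Let rr xi eta := fine (boundary_rho xi eta).

Let eps_cancel (a : R) : - eps * (- a / eps) = a.
Proof. by field; rewrite gt_eqF. Qed.

Lemma boundary_rho_fin xi eta : A xi -> A eta ->
  boundary_rho xi eta \is a fin_num.
Proof.
move=> Axi Aeta; rewrite /boundary_rho.
have := boundary_product_gtNy Axi Aeta.
case: boundary_product => [s| |] //= _.
by rewrite mulry /= sgrN gtr0_sg// mulN1e.
Qed.

Lemma boundary_rho_ge0 xi eta : (0%:E <= boundary_rho xi eta)%E.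
Proof. exact: expeR_ge0. Qed.

Lemma boundary_rho_lt xi eta (t : R) : A xi -> A eta ->
  rr xi eta < expR (- eps * t) -> (t%:E < boundary_product xi eta)%E.
Proof.
move=> Axi Aeta; rewrite /rr /boundary_rho.
have := boundary_product_gtNy Axi Aeta.
case: boundary_product => [s| |] //= _; last by rewrite ltry.
by rewrite ltr_expR lte_fin !mulNr ltrN2 ltr_pM2l.
Qed.

Lemma boundary_rho_gt xi eta (t : R) : A xi -> A eta ->
  expR (- eps * t) < rr xi eta -> (boundary_product xi eta < t%:E)%E.
Proof.
move=> Axi Aeta; rewrite /rr /boundary_rho.
have := boundary_product_gtNy Axi Aeta.
case: boundary_product => [s| |] //= _.
  by rewrite ltr_expR lte_fin !mulNr ltrN2 ltr_pM2l.
rewrite mulry /= sgrN gtr0_sg// mulN1e/=.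
by rewrite ltNge expR_ge0.
Qed.

Lemma boundary_rho_ultra xi eta zeta : A xi -> A eta -> A zeta ->
  rr xi zeta <= expR (eps * dl) * Num.max (rr xi eta) (rr eta zeta).
Proof.
move=> Axi Aeta Azeta; set m := Num.max _ _.
have m0 : 0 <= m by rewrite le_max fine_ge0 ?boundary_rho_ge0.
suff h s : m < s -> rr xi zeta <= expR (eps * dl) * s.
  rewrite -ler_pdivrMl ?expR_gt0//; apply/ler_addgt0Pr => e e0.
  by rewrite ler_pdivrMl ?expR_gt0//; apply: h; lra.
move=> ms; have s0 : 0 < s by lra.
pose t := - ln s / eps.
have ts : s = expR (- eps * t).
  by rewrite eps_cancel lnK.
move: ms; rewrite gt_max ts => /andP[/boundary_rho_lt + /boundary_rho_lt].
move=> /(_ Axi Aeta) h1 /(_ Aeta Azeta) h2.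
have := boundary_product_ultra Aeta h1 h2.
rewrite /rr /boundary_rho -expRD.
case: boundary_product => [p| |] //=.
  rewrite lee_fin ler_expR => /(ler_wpM2l (ltW eps_gt0)).
  by rewrite mulrBr !mulNr; lra.
by move=> _; rewrite mulry /= sgrN gtr0_sg// mulN1e/= expR_ge0.
Qed.

Hypothesis eps_dl : expR (2 * eps * dl) <= 2.

(** The condition on [eps] makes the chain distance comparable with
    [boundary_rho].  In a ball all pairwise products are then bounded below by
    some [t], and separation at half the radius bounds them above by [t] plus a
    constant depending only on [eps] and [dl]. *)
Lemma boundary_doubling :
  (forall D, exists N, forall t (u : nat -> nat -> X),
     (forall i, (i < N)%N -> exists2 xi, A xi & xi (u i)) ->
     (forall i j, (i < j < N)%N ->
        \forall m \near \oo, t <= P (u i m) (u j m)) ->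
     exists i j, (i < j < N)%N /\
       ~ \forall m \near \oo, P (u i m) (u j m) < t + D) ->
  doubling A (chain_dist A boundary_rho).
Proof.
move=> pack.
have K1 : 1 <= expR (eps * dl).
  by rewrite -expR0 ler_expR mulr_ge0// ltW.
have K2 : expR (eps * dl) ^+ 2 <= 2.
  by rewrite -expRM_natl mulrA.
have dist_ge x y : A x -> A y -> rr x y <= 2 * chain_dist A boundary_rho x y.
  move=> Ax Ay; apply: chain_dist_ge K1 K2 _ Ax Ay.
  - exact: boundary_rho_fin.
  - exact: boundary_rho_ge0.
  - exact: boundary_rho_ultra.
have dist_le x y : A x -> A y -> chain_dist A boundary_rho x y <= rr x y.
  by apply: chain_dist_le; [exact: boundary_rho_fin|exact: boundary_rho_ge0].
(* exp (- eps * D0) = 1 / 8 is the ratio of the threshold r / 4, below the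
   separation r / 2, to the bound 2 * r on rho in the ball *)
pose D0 := ln 8 / eps.
have [N packN] := pack (D0 + 3 * dl + 1).
apply: (@doubling_of_packing _ _ _ _ N) => x r y Ax r0 yb.
apply: contrapT => nsep.
have sep i j : (i < j < N)%N -> r / 4 < rr (y i) (y j).
  move=> ij; rewrite ltNge; apply/negP => rle; apply: nsep.
  exists i, j; split=> //; apply: le_lt_trans (dist_le _ _ _ _) _.
  - by case/andP: ij => ij jN; case: (yb i (ltn_trans ij jN)).
  - by case/andP: ij => _ /yb[].
  - by apply: (le_lt_trans rle); lra.
pose t := - ln (2 * r) / eps.
have tr : 2 * r = expR (- eps * t).
  rewrite eps_cancel lnK// posrE; lra.
have tr4 : r / 4 = expR (- eps * (t + D0)).
  have -> : D0 = - - ln 8 / eps by rewrite opprK.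
  by rewrite mulrDr expRD -tr eps_cancel expRN lnK ?posrE//; field.
have [u0 xu0] := A_neq0 Ax.
have [u uy] : exists u : nat -> nat -> X, forall i, (i < N)%N -> y i (u i).
  have h i : exists u, (i < N)%N -> y i u.
    case: (ltnP i N) => [iN|_]; last by exists u0.
    by have [Ayi _] := yb i iN; have [u yu] := A_neq0 Ayi; exists u.
  by have [u hu] := choice h; exists u.
have near_x i : (i < N)%N -> \forall m \near \oo, t <= P (u0 m) (u i m).
  move=> iN; have [Ayi di] := yb i iN.
  apply: (boundary_product_lt xu0 (uy i iN)).
  apply: boundary_rho_lt => //; rewrite -tr.
  by have := dist_ge x (y i) Ax Ayi; lra.
have [i [j [/andP[ij jN]]]] : exists i j, (i < j < N)%N /\
    ~ \forall m \near \oo, P (u i m) (u j m) < t - dl + (D0 + 3 * dl + 1).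
  apply: packN => [i iN|i j /andP[ij jN]].
    by exists (y i); [case: (yb i iN)|exact: uy].
  have := near_x _ (ltn_trans ij jN); have := near_x _ jN.
  by apply: filterS2 => m hj hi; apply: Pultra_le hj; rewrite Psym.
apply; have iN := ltn_trans ij jN.
have [Ayi _] := yb i iN; have [Ayj _] := yb j jN.
have : (boundary_product (y i) (y j) < (t + D0)%:E)%E.
  by apply: boundary_rho_gt => //; rewrite -tr4 sep// ij jN.
move/(boundary_product_gt Ayi Ayj (uy i iN) (uy j jN)).
by apply: filterS => m; lra.
Qed.

End Rho.
End BoundaryProduct.

(** * Packing of Gromov products *)

Section Hyperbolic.
Context {R : realType} {X : Type}.
Variables (d : X -> X -> R) (dl : R).
Hypothesis dxx : forall x, d x x = 0.
Hypothesis dsym : forall x y, d x y = d y x.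
Hypothesis dtri : forall y x z, d x z <= d x y + d y z.
Hypothesis dhyp : delta_hyperbolic d dl.

Local Notation gp := (gromov_product d).

Let dl_ge0 : 0 <= dl. Proof. by case: dhyp. Qed.

Lemma gromov_productC w x y : gp w x y = gp w y x.
Proof. by rewrite /gromov_product (dsym x y) [d x w + _]addrC. Qed.

Lemma gromov_product_ge0 w x y : 0 <= gp w x y.
Proof.
rewrite /gromov_product; have := dtri w x y; rewrite (dsym w y); lra.
Qed.

Lemma gromov_product_lel w x y : gp w x y <= d x w.
Proof. rewrite /gromov_product; have := dtri x y w; rewrite (dsym y x); lra. Qed.

Lemma gromov_product_base w w' x y : gp w' x y - d w w' <= gp w x y.
Proof.
rewrite /gromov_product; have := dtri w x w'; have := dtri w y w'; lra.
Qed.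

Lemma hyperbolic_le w t x y z :
  t <= gp w x z -> t <= gp w z y -> t - dl <= gp w x y.
Proof.
move=> xz zy; apply: le_trans (dhyp.2 x y z w).
by rewrite lerD2r le_min xz zy.
Qed.

Lemma hyperbolic2_le w t x y z z' :
  t <= gp w x z -> t <= gp w z z' -> t <= gp w z' y ->
  t - 2 * dl <= gp w x y.
Proof.
move=> xz zz zy; have h := hyperbolic_le zz zy.
have xz' : t - dl <= gp w x z by have := dl_ge0; lra.
by have := hyperbolic_le xz' h; lra.
Qed.

Section Core.
Hypothesis dmid : forall x y (t : R), 0 <= t <= d x y ->
  exists z, d x z <= t /\ d z y <= d x y - t + 1.
Hypothesis dpack : forall r, exists N, forall y : nat -> X,
  (forall i j, (i < N)%N -> (j < N)%N -> d (y i) (y j) <= r) ->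
  exists i j, (i < j < N)%N /\ d (y i) (y j) <= 1.

(** Cut approximate geodesics from [p] to the points [b i] at time [t + M].  As
    the geodesics stay together up to time [t], the cut points lie within a
    distance depending only on [M] and [dl] of each other, so two of them are within
    distance [1], which bounds the product of the two ends below. *)
Lemma gromov_product_packing D : exists (N : nat) (M : R),
  forall p t (b : nat -> X), 0 <= t ->
    (forall i j, (i < j < N)%N -> t <= gp p (b i) (b j)) ->
    (forall i, (i < N)%N -> t + M <= d p (b i)) ->
    exists i j, (i < j < N)%N /\ t + D <= gp p (b i) (b j).
Proof.
(* 2 * dl is lost when passing from the cut points to the ends, and at most 3 / 2
   by the slack 1 in the choice of the cut points and their distance 1 *)
pose M := Num.max D 0 + 2 + 2 * dl.
have [DM M2] : D + 2 + 2 * dl <= M /\ 2 <= M.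
  have : D <= Num.max D 0 /\ 0 <= Num.max D 0 by rewrite !le_max !lexx orbT.
  by have := dl_ge0; rewrite /M; lra.
have [N packN] := dpack (2 * M + 4 * dl).
exists N, M => p t b t0 bb far.
have [y yP] : exists y : nat -> X, forall i, (i < N)%N ->
    d p (y i) <= t + M /\ d (y i) (b i) <= d p (b i) - (t + M) + 1.
  suff : forall i, exists z, (i < N)%N ->
      d p z <= t + M /\ d z (b i) <= d p (b i) - (t + M) + 1.
    by move/choice => [y yP]; exists y.
  move=> i; case: (ltnP i N) => [iN|_]; last by exists (b i).
  have [|z zP] := @dmid p (b i) (t + M); first by rewrite far// andbT; lra.
  by exists z.
have py i : (i < N)%N -> t + M - 1 <= d p (y i).
  by move=> iN; have [? ?] := yP i iN; have := dtri (y i) p (b i); lra.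
have yb i : (i < N)%N -> t + M - 1 <= gp p (y i) (b i).
  move=> iN; have [? ?] := yP i iN; have := py i iN; have := far i iN.
  by rewrite /gromov_product !(dsym _ p); lra.
have yy i j : (i < j < N)%N -> d (y i) (y j) <= 2 * M + 4 * dl.
  move=> /andP[ij jN]; have iN := ltn_trans ij jN.
  have yit : t <= gp p (y i) (b i) by have := yb i iN; lra.
  have yjt : t <= gp p (b j) (y j).
    by have := yb j jN; rewrite (gromov_productC p (y j)); lra.
  have := hyperbolic2_le yit (bb i j _) yjt; rewrite ij jN => /(_ isT).
  have [? _] := yP i iN; have [? _] := yP j jN.
  by rewrite /gromov_product !(dsym _ p); lra.
have [i j iN jN|i [j [/andP[ij jN] dij]]] := packN y.
  case: (ltngtP i j) => [ij|ji|->]; first by rewrite yy// ij.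
    by rewrite dsym yy// ji.
  by rewrite dxx; have := dl_ge0; lra.
have iN := ltn_trans ij jN.
exists i, j; rewrite ij jN; split => //.
have yij : t + M - 3 / 2 <= gp p (y i) (y j).
  have := py i iN; have := py j jN.
  by rewrite /gromov_product !(dsym _ p); lra.
have byi : t + M - 3 / 2 <= gp p (b i) (y i).
  by rewrite gromov_productC; have := yb i iN; lra.
have ybj : t + M - 3 / 2 <= gp p (y j) (b j) by have := yb j jN; lra.
by have := hyperbolic2_le byi yij ybj; lra.
Qed.
End Core.
End Hyperbolic.

(** * Bourdon and Hamenstaedt metrics *)

Section GromovBoundary.
Context {R : realType} {X : Type}.
Variables (d : X -> X -> R) (dl : R).
Hypothesis dxx : forall x, d x x = 0.
Hypothesis dsym : forall x y, d x y = d y x.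
Hypothesis dtri : forall y x z, d x z <= d x y + d y z.
Hypothesis dhyp : delta_hyperbolic d dl.

Local Notation gp := (gromov_product d).
Local Notation bd := (gromov_boundary d).

Let dl_ge0 : 0 <= dl. Proof. by case: dhyp. Qed.
Let gpC := gromov_productC dsym.
Let gp_ge0 := gromov_product_ge0 dsym dtri.
Let gp_lel := gromov_product_lel dsym dtri.
Let gp_base := gromov_product_base dtri.
Let hyp2 := hyperbolic2_le dhyp.
Let hyp1 := hyperbolic_le dhyp.

Lemma gromov_sequence_diverges u : gromov_sequence d u ->
  forall w B, exists N, forall n m, (N <= n)%N -> (N <= m)%N ->
    B <= gp w (u n) (u m).
Proof.
move=> us w B; have /cvgryPge /(_ B) := us w.
move=> [[F G] [[N1 _ F1] [N2 _ G1]]] FG; exists (maxn N1 N2) => n m.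
rewrite !geq_max => /andP[n1 _] /andP[_ m2].
by apply: (FG (n, m)); split; [exact: F1|exact: G1].
Qed.

Lemma gromov_class_refl u : gromov_sequence d u -> gromov_class d u u.
Proof.
move=> us; split => // w; apply/cvgryPge => B.
have [N hN] := gromov_sequence_diverges us w B.
by exists N => // n /= nN; exact: hN.
Qed.

Lemma gromov_boundary_neq0 xi : bd xi -> exists u, xi u.
Proof. by move=> [u us <-]; exists u; exact: gromov_class_refl. Qed.

Lemma gromov_boundary_diverges xi u v : bd xi -> xi u -> xi v ->
  forall w B, exists N, forall n m, (N <= n)%N -> (N <= m)%N ->
    B <= gp w (u n) (v m).
Proof.
move=> [z zs <-] [us zu] [vs zv] w B.
have [N0 h0] := gromov_sequence_diverges zs w (B + 2 * dl).
have /cvgryPge /(_ (B + 2 * dl)) [N1 _ h1] := zu w.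
have /cvgryPge /(_ (B + 2 * dl)) [N2 _ h2] := zv w.
exists (maxn N0 (maxn N1 N2)) => n m.
rewrite !geq_max => /and3P[n0 n1 n2] /and3P[m0 m1 m2].
have -> : B = B + 2 * dl - 2 * dl by ring.
by apply: hyp2 (h0 _ _ n0 m0) (h2 _ m2); rewrite gpC; exact: h1.
Qed.

Lemma gromov_boundary_far xi u : bd xi -> xi u ->
  forall w B, \forall n \near \oo, B <= d w (u n).
Proof.
move=> xiA xiu w B; have [N hN] := gromov_boundary_diverges xiA xiu xiu w B.
by exists N => // n /= nN; rewrite dsym; apply: le_trans (gp_lel _ _ (u n)); exact: hN.
Qed.

(** The terms of each sequence have large products with one another, so a single
    large cross product far out makes all later ones large.  Changing the base
    point shifts products by a bounded amount, so one base point decides. *)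
Lemma gromov_boundary_eq w xi eta u v : bd xi -> bd eta -> xi u -> eta v ->
  (forall B, exists n m, B <= gp w (u n) (v m) /\
     (forall i, (n <= i)%N -> B <= gp w (u i) (u n)) /\
     (forall i, (m <= i)%N -> B <= gp w (v m) (v i))) ->
  xi = eta.
Proof.
move=> xiA etaA xiu etav uv.
have cross B : \forall n \near \oo, B <= gp w (u n) (v n).
  have [n [m [nm [hu hv]]]] := uv (B + 2 * dl).
  exists (maxn n m) => // i /=; rewrite geq_max => /andP[ni mi].
  have -> : B = B + 2 * dl - 2 * dl by ring.
  exact: hyp2 (hu i ni) nm (hv i mi).
have equiv z z' : xi z -> eta z' -> forall w', gp w' (z n) (z' n) @[n --> \oo] --> +oo.
  move=> xiz etaz' w'; apply/cvgryPge => B.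
  pose B' := B + d w' w + 2 * dl.
  have [N1 h1] := gromov_boundary_diverges xiA xiz xiu w B'.
  have [N2 h2] := gromov_boundary_diverges etaA etav etaz' w B'.
  have [N _ h] := cross B'.
  exists (maxn N (maxn N1 N2)) => // n /=; rewrite !geq_max => /and3P[n0 n1 n2].
  apply: le_trans (gp_base w' w _ _).
  suff : B' - 2 * dl <= gp w (z n) (z' n) by rewrite /B'; lra.
  exact: hyp2 (h1 _ _ n1 n1) (h _ n0) (h2 _ _ n2 n2).
case: (xiA) => x xs xiE; case: (etaA) => y ys etaE.
have xix : xi x by rewrite -xiE; exact: gromov_class_refl.
have etay : eta y by rewrite -etaE; exact: gromov_class_refl.
apply/seteqP; split => z zz.
- rewrite -etaE; split; first by move: zz; rewrite -xiE => -[].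
  move=> w'; have := equiv z y zz etay w'.
  by under eq_fun do rewrite gpC.
- rewrite -xiE; split; first by move: zz; rewrite -etaE => -[].
  exact: equiv x z xix zz.
Qed.

Lemma gromov_boundary_neq w xi eta u v : bd xi -> bd eta -> xi <> eta ->
  xi u -> eta v ->
  exists B N, forall n m, (N <= n)%N -> (N <= m)%N -> gp w (u n) (v m) <= B.
Proof.
move=> xiA etaA neq xiu etav; apply: contrapT => nb; apply: neq.
apply: (gromov_boundary_eq (w := w) xiA etaA xiu etav) => B.
have [N1 h1] := gromov_boundary_diverges xiA xiu xiu w B.
have [N2 h2] := gromov_boundary_diverges etaA etav etav w B.
apply: contrapT => nex; apply: nb; exists B, (maxn N1 N2) => n m.
rewrite !geq_max => /andP[n1 n2] /andP[m1 m2].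
rewrite leNgt; apply/negP => /ltW Bnm; apply: nex; exists n, m.
split => //; split=> i ni; first by apply: h1 => //; exact: leq_trans ni.
by apply: h2 => //; exact: leq_trans ni.
Qed.

Section Doubling.
Hypothesis dmid : forall x y (t : R), 0 <= t <= d x y ->
  exists z, d x z <= t /\ d z y <= d x y - t + 1.
Hypothesis dpack : forall r, exists N, forall y : nat -> X,
  (forall i j, (i < N)%N -> (j < N)%N -> d (y i) (y j) <= r) ->
  exists i j, (i < j < N)%N /\ d (y i) (y j) <= 1.

Let packing := gromov_product_packing dxx dsym dtri dhyp dmid dpack.

Theorem bourdon_doubling eps w : bourdon_parameter dl eps ->
  doubling bd (bourdon_dist d w eps).
Proof.
move=> [eps0 eps1 eps5].
apply: (@boundary_doubling _ _ (gp w) dl) => //.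
- by move=> x y z; exact: dhyp.2.
- exact: gromov_boundary_neq0.
- by move=> xi u v xiA xiu xiv; exact: (gromov_boundary_diverges xiA xiu xiv w).
- move=> xi eta /gromov_boundary_neq0[u xiu] /gromov_boundary_neq0[v etav].
  by exists u, v, 0; split => //; near=> n; exact: gp_ge0.
(* exp (- 2 * eps * dl) >= 1 - 2 * eps * dl >= 1 - 2 / 5 *)
- have := expR_ge1Dx (- (2 * eps * dl)).
  have := expR_gt0 (2 * eps * dl).
  rewrite expRN => e0 h; rewrite -[leRHS]invrK -[leLHS]invrK.
  by rewrite lef_pV2 ?posrE ?invr_gt0//; lra.
move=> D; have [N [M packN]] := packing D.
exists N => t u reps near_t; apply: contrapT => nsep.
have near_lt i j : (i < j < N)%N ->
    \forall m \near \oo, gp w (u i m) (u j m) < t + D.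
  by move=> ij; apply: contrapT => nn; apply: nsep; exists i, j.
pose t' := Num.max t 0.
have far : \forall m \near \oo, forall i, (i < N)%N -> t' + M <= d w (u i m).
  apply: near_lt_all => i iN; have [xi xiA xiu] := reps i iN.
  exact: gromov_boundary_far xiA xiu _ _.
have [m [[lt_m le_m] far_m]] := @filter_ex _ \oo _ _
  (filterI (filterI (near_lt_pairs near_lt) (near_lt_pairs near_t)) far).
have [|i j ij||i [j [ij]]] := packN w t' (fun i => u i m).
- by rewrite le_max lexx orbT.
- by rewrite ge_max gp_ge0 le_m.
- exact: far_m.
have := lt_m i j ij; have : t <= t' by rewrite le_max lexx.
lra.
Unshelve. all: by end_near. Qed.

Section Busemann.
Variables (xi : set (nat -> X)) (w : X).
Hypothesis xi_bd : bd xi.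

Local Notation b := (busemann d xi w).

(** The infimum over all representatives is a lower bound for [c], and by
    hyperbolicity no representative exceeds it by more than [dl] in the limit. *)
Lemma gromov_product_pt_approx x a c e : xi c -> 0 < e ->
  \forall n \near \oo,
    fine (gromov_product_pt d x a xi) - e <= gp x a (c n)
      <= fine (gromov_product_pt d x a xi) + dl + e.
Proof.
move=> xic e0; set q := gromov_product_pt d x a xi.
have lower t : (t%:E < q)%E -> \forall n \near \oo, t <= gp x a (c n).
  move=> tq; apply: (limn_einf_gtP (a := fun n => gp x a (c n))).
  by apply: lt_le_trans tq _; apply: ereal_inf_lbound; exists c.
have q0 : (0%:E <= q)%E.
  apply: le_ereal_inf_tmp => _ [v xiv <-].
  by apply: limn_einf_geP; near=> n; exact: gp_ge0.
have qy : q != +oo%E.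
  apply/negP => /eqP qE.
  have /filter_ex[n] : \forall n \near \oo, d a x + 1 <= gp x a (c n).
    by apply: lower; rewrite qE ltry.
  by have := gp_lel x a (c n); lra.
have [r qr] : exists r, q = r%:E.
  by case: (q) q0 qy => [r| |] //; exists r.
rewrite qr /=.
suff up : \forall n \near \oo, gp x a (c n) <= r + dl + e.
  have lo : \forall n \near \oo, r - e <= gp x a (c n).
    by apply: lower; rewrite qr lte_fin; lra.
  by apply: filterS2 lo up => n -> ->.
have : (q < (r + e)%:E)%E by rewrite qr lte_fin; lra.
move=> /ereal_inf_lt[_ [v xiv <-]] vlt.
have [N hN] := gromov_boundary_diverges xi_bd xiv xic x (r + dl + e).
exists N => // n /= nN; rewrite leNgt; apply/negP => lt_n.
suff : ((r + e)%:E <= limn_einf (fun i => (gp x a (v i))%:E))%E.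
  by rewrite leNgt vlt.
apply: limn_einf_geP; exists N => // m /= mN.
have -> : r + e = r + dl + e - dl by ring.
by apply: hyp1 (ltW lt_n) _; rewrite gpC; exact: hN.
Unshelve. all: by end_near. Qed.

(** The difference of the two Gromov products at [c n] is exactly
    [d (c n) x - d (c n) w].  Both products err by at most [dl] in the same
    direction, so their difference errs by at most [dl] as well. *)
Lemma busemann_approx x c e : xi c -> 0 < e ->
  \forall n \near \oo, `|b x - (d (c n) x - d (c n) w)| <= dl + e.
Proof.
move=> xic e0; have e20 : 0 < e / 2 by lra.
apply: filterS2 (gromov_product_pt_approx x w xic e20)
  (gromov_product_pt_approx w x xic e20) => n.
rewrite /busemann /gromov_product (dsym w x) (dsym w (c n)) (dsym x (c n)).
by rewrite ler_norml; lra.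
Qed.

Lemma busemann_product_approx x y c e : xi c -> 0 < e ->
  \forall n \near \oo,
    `|busemann_product d b x y - (gp (c n) x y - d (c n) w)| <= dl + e.
Proof.
move=> xic e0.
apply: filterS2 (busemann_approx x xic e0) (busemann_approx y xic e0) => n.
rewrite /busemann_product /gromov_product (dsym x (c n)) (dsym y (c n)).
by rewrite !ler_norml; lra.
Qed.

Lemma busemann_product_ultra x y z :
  Num.min (busemann_product d b x z) (busemann_product d b z y) - 3 * dl
    <= busemann_product d b x y.
Proof.
have [c xic] := gromov_boundary_neq0 xi_bd.
apply/ler_addgt0Pr => e e0; have e20 : 0 < e / 2 by lra.
have [n [[hxy hxz] hzy]] := @filter_ex _ \oo _ _ (filterI (filterI
  (busemann_product_approx x y xic e20) (busemann_product_approx x z xic e20))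
  (busemann_product_approx z y xic e20)).
set m := Num.min _ _.
have mxz : m <= busemann_product d b x z by rewrite ge_min lexx.
have mzy : m <= busemann_product d b z y by rewrite ge_min lexx orbT.
have := @hyp1 (c n) (m + d (c n) w - dl - e / 2) x y z.
by move: hxy hxz hzy; rewrite !ler_norml; lra.
Qed.

(** The Gromov product of [x] and [y] based at [c n], minus [d (c n) w], equals
    [gp w x y - gp w x (c n) - gp w y (c n)]. *)
Lemma busemann_product_ge x y c B1 B2 : xi c ->
  (\forall n \near \oo, gp w x (c n) <= B1) ->
  (\forall n \near \oo, gp w y (c n) <= B2) ->
  gp w x y - B1 - B2 - dl - 1 <= busemann_product d b x y.
Proof.
move=> xic h1 h2.
have [n [[n1 n2]]] := @filter_ex _ \oo _ _ (filterI (filterI h1 h2)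
  (busemann_product_approx x y xic ltr01)).
move: n1 n2; rewrite /gromov_product (dsym x (c n)) (dsym y (c n)).
by rewrite ler_norml; lra.
Qed.

Lemma punctured_boundary_bounded eta u c : punctured_boundary d xi eta ->
  eta u -> xi c ->
  exists B N, forall n, (N <= n)%N -> \forall m \near \oo, gp w (u n) (c m) <= B.
Proof.
move=> [etaA neq] etau xic.
have [B [N h]] := gromov_boundary_neq w etaA xi_bd neq etau xic.
by exists B, N => n nN; exists N => // m /= mN; exact: h.
Qed.

Lemma busemann_product_diverges eta u v : punctured_boundary d xi eta ->
  eta u -> eta v ->
  forall B, exists N, forall n m, (N <= n)%N -> (N <= m)%N ->
    B <= busemann_product d b (u n) (v m).
Proof.
move=> etaA etau etav B; have [c xic] := gromov_boundary_neq0 xi_bd.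
have [B1 [N1 h1]] := punctured_boundary_bounded etaA etau xic.
have [B2 [N2 h2]] := punctured_boundary_bounded etaA etav xic.
have [N hN] := gromov_boundary_diverges etaA.1 etau etav w (B + B1 + B2 + dl + 1).
exists (maxn N (maxn N1 N2)) => n m.
rewrite !geq_max => /and3P[n0 n1 n2] /and3P[m0 m1 m2].
have := busemann_product_ge xic (h1 n n1) (h2 m m2).
by have := hN n m n0 m0; lra.
Qed.

(** The packing property of Gromov products is uniform in the base point, so it
    can be used at a point [c n] that is chosen far out only after all the other
    points have been fixed. *)
Theorem hamenstadt_doubling eps : hamenstadt_parameter dl eps ->
  doubling (punctured_boundary d xi) (hamenstadt_dist d xi w eps).
Proof.
move=> [eps0 eps22].
have [c xic] := gromov_boundary_neq0 xi_bd.
apply: (@boundary_doubling _ _ (busemann_product d b) (3 * dl)) => //.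
- by rewrite mulr_ge0.
- by move=> x y; rewrite /busemann_product dsym [b x + _]addrC.
- exact: busemann_product_ultra.
- by move=> eta [/gromov_boundary_neq0].
- by move=> eta u v etaA etau etav; exact: (busemann_product_diverges etaA etau etav).
- move=> eta zeta etaA zetaA.
  have [u etau] := gromov_boundary_neq0 etaA.1.
  have [v zetav] := gromov_boundary_neq0 zetaA.1.
  have [B1 [N1 h1]] := punctured_boundary_bounded etaA etau xic.
  have [B2 [N2 h2]] := punctured_boundary_bounded zetaA zetav xic.
  exists u, v, (- B1 - B2 - dl - 1); split => //.
  exists (maxn N1 N2) => // n /=; rewrite geq_max => /andP[n1 n2].
  have := busemann_product_ge xic (h1 n n1) (h2 n n2).
  by have := gp_ge0 w (u n) (v n); lra.
- apply: le_trans eps22; rewrite ler_expR.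
  by have := mulr_ge0 (ltW eps0) dl_ge0; lra.
move=> D; have [N [M packN]] := packing (D + 2 * dl + 2).
exists N => t u reps near_t; apply: contrapT => nsep.
have near_lt i j : (i < j < N)%N ->
    \forall m \near \oo, busemann_product d b (u i m) (u j m) < t + D.
  by move=> ij; apply: contrapT => nn; apply: nsep; exists i, j.
have far : \forall m \near \oo, forall i, (i < N)%N -> t + M <= b (u i m).
  apply: near_lt_all => i iN; have [eta etaA etau] := reps i iN.
  have [K hK] := busemann_product_diverges etaA etau etau (t + M).
  exists K => // m /= mK; have := hK m m mK mK.
  by rewrite /busemann_product dxx; lra.
have [m [[lt_m le_m] far_m]] := @filter_ex _ \oo _ _
  (filterI (filterI (near_lt_pairs near_lt) (near_lt_pairs near_t)) far).
have near_c : \forall n \near \oo, forall i, (i < N)%N ->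
    `|b (u i m) - (d (c n) (u i m) - d (c n) w)| <= dl + 1.
  by apply: near_lt_all => i iN; exact: busemann_approx.
have near_cc : \forall n \near \oo, forall i j, (i < j < N)%N ->
    `|busemann_product d b (u i m) (u j m)
        - (gp (c n) (u i m) (u j m) - d (c n) w)| <= dl + 1.
  by apply: near_lt_pairs => i j ij; exact: busemann_product_approx.
have [n [[hc hcc] dcw]] := @filter_ex _ \oo _ _ (filterI
  (filterI near_c near_cc) (gromov_boundary_far xi_bd xic w (dl + 1 - t))).
pose t' := t + d (c n) w - dl - 1.
have [|i j ij|i iN|i [j [ij]]] := packN (c n) t' (fun i => u i m).
- by rewrite /t' (dsym (c n)); lra.
- by have := hcc i j ij; have := le_m i j ij; rewrite /t' ler_norml; lra.
- by have := hc i iN; have := far_m i iN; rewrite /t' ler_norml; lra.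
by have := hcc i j ij; have := lt_m i j ij; rewrite /t' ler_norml; lra.
Qed.

End Busemann.
End Doubling.
End GromovBoundary.

(** * Distance to the metric boundary *)

Section BoundaryDistance.
Context {R : realType} {T : metricType R}.
Implicit Types (x y : T) (u v : nat -> T).

Lemma metric_cvgP u x : u @ \oo --> x <-> mdist x (u n) @[n --> \oo] --> (0 : R).
Proof.
rewrite (metricType_numDomainType.cvgrPdist_lt u x) cvgr0Pnorm_lt.
by split=> h e /h; apply: filterS => n; rewrite ger0_norm ?mdist_ge0.
Qed.

Lemma cauchy_seqP u : cauchy_seq u <->
  forall e, 0 < e -> exists N, forall n m, (N <= n)%N -> (N <= m)%N ->
    mdist (u n) (u m) < e.
Proof.
rewrite /cauchy_seq -cauchy_ballP; split => h e e0.
  have [[F G] [[N1 _ F1] [N2 _ G1]] FG] := h e e0.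
  exists (maxn N1 N2) => n m; rewrite !geq_max => /andP[n1 _] /andP[_ m2].
  have := FG (u n, u m); rewrite /= ballEmdist /=; apply.
  by split; [exact: F1|exact: G1].
have [N hN] := h e e0.
exists ([set u n | n in [set n | (N <= n)%N]], [set u n | n in [set n | (N <= n)%N]]).
  by split; exists N => // n nN; exists n.
by move=> [_ _] [/= [n nN <-] [m mN <-]]; rewrite ballEmdist /=; exact: hN.
Qed.

Lemma cauchy_dist_cvg u x : cauchy_seq u ->
  exists l : R, mdist x (u n) @[n --> \oo] --> l.
Proof.
move=> /cauchy_seqP uc.
suff : cvgn (fun n => mdist x (u n)) by move=> /cvg_ex.
apply/cauchy_cvgP/cauchy_ballP => e e0; have [N hN] := uc e e0.
pose S := [set mdist x (u n) | n in [set n | (N <= n)%N]].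
exists (S, S); first by split; exists N => // n nN; exists n.
move=> [_ _] [/= [n nN <-] [m mN <-]]; rewrite /ball /= ltr_norml.
have := hN n m nN mN; have := metric_triangle x (u n) (u m).
have := metric_triangle x (u m) (u n); rewrite (metric_sym (u m) (u n)).
lra.
Qed.

Lemma cauchy_class_refl u : cauchy_seq u -> cauchy_class u u.
Proof.
by move=> uc; split=> //; under eq_fun do rewrite mdistxx; exact: cvg_cst.
Qed.

Lemma cauchy_seq_cst x : cauchy_seq (fun=> x).
Proof. by apply/cauchy_seqP => e e0; exists 0%N => n m _ _; rewrite mdistxx. Qed.

(** Replacing the representatives by equivalent ones does not change the limit,
    so the infimum is over a single value. *)
Lemma completion_dist_embed x u (l : R) : cauchy_seq u ->
  mdist x (u n) @[n --> \oo] --> l ->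
  completion_dist (completion_embed x) (cauchy_class u) = l.
Proof.
move=> uc xul; rewrite /completion_dist.
suff -> : [set r | exists a b, [/\ completion_embed x a, cauchy_class u b &
    mdist (a n) (b n) @[n --> \oo] --> r]] = [set l] by rewrite inf1.
apply/seteqP; split => [r [a [b [[_ xa] [_ ub] abr]]]|_ ->]; last first.
  exists (fun=> x), u; split => //; last exact: cauchy_class_refl.
  exact/cauchy_class_refl/cauchy_seq_cst.
apply: (cvg_unique _ abr) => //.
have lim1 : mdist x (u n) - (mdist x (a n) + mdist (u n) (b n)) @[n --> \oo] --> l.
  by rewrite -[l]subr0 -[X in _ - X]addr0; apply: cvgB => //; exact: cvgD.
have lim2 : mdist x (u n) + (mdist x (a n) + mdist (u n) (b n)) @[n --> \oo] --> l.
  by rewrite -[l]addr0 -[X in _ + X]addr0; apply: cvgD => //; exact: cvgD.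
apply: squeeze_cvgr lim1 lim2; near=> n.
have := metric_triangle x (a n) (u n); have := metric_triangle (a n) (b n) (u n).
have := metric_triangle (a n) x (b n); have := metric_triangle x (u n) (b n).
rewrite (metric_sym (a n) x) (metric_sym (b n) (u n)).
lra.
Unshelve. all: by end_near. Qed.

Lemma metric_boundaryP p : metric_boundary p ->
  exists u, [/\ cauchy_seq u, forall l : T, ~ u @ \oo --> l &
    forall x : T, mdist x (u n) @[n --> \oo] -->
                    completion_dist (completion_embed x) p].
Proof.
move=> [[u uc <-] nu]; exists u; split=> // [l ul|x]; last first.
  by have [r xur] := cauchy_dist_cvg x uc; rewrite (completion_dist_embed uc xur).
apply: nu; exists l => //; move/metric_cvgP : ul => ul.
apply/seteqP; split => v [vc vl]; split => //.
- have : mdist l (u n) + mdist l (v n) @[n --> \oo] --> (0 : R).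
    by rewrite -[0]addr0; exact: cvgD.
  apply: squeeze_cvgr (cvg_cst 0); near=> n; rewrite mdist_ge0.
  by rewrite (metric_sym l (u n)) metric_triangle.
- have : mdist l (u n) + mdist (u n) (v n) @[n --> \oo] --> (0 : R).
    by rewrite -[0]addr0; exact: cvgD.
  apply: squeeze_cvgr (cvg_cst 0); near=> n.
  by rewrite mdist_ge0 metric_triangle.
Unshelve. all: by end_near. Qed.

Lemma metric_boundary_neq0 : incomplete T ->
  exists p : set (nat -> T), metric_boundary p.
Proof.
move=> inc; apply: contrapT => nex; apply: inc => u uc.
apply: contrapT => nu; apply: nex; exists (cauchy_class u).
split; first by exists u.
move=> [x _ xu]; apply: nu; exists x; apply/metric_cvgP.
have : completion_embed x u by rewrite xu; exact: cauchy_class_refl.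
by case.
Qed.

Let dists x := [set completion_dist (completion_embed x) p | p in metric_boundary].

Lemma completion_dist_ge0 x p : metric_boundary p ->
  0 <= completion_dist (completion_embed x) p.
Proof.
move=> /metric_boundaryP[u [_ _ /(_ x) ux]].
by apply: (ler_cvg_to (cvg_cst 0) ux); near=> n; exact: mdist_ge0.
Unshelve. all: by end_near. Qed.

Let dists_lb x : has_lbound (dists x).
Proof. by exists 0 => _ [p pb <-]; exact: completion_dist_ge0. Qed.

Lemma boundary_dist_lip x y : incomplete T ->
  boundary_dist x <= boundary_dist y + mdist x y.
Proof.
move=> /metric_boundary_neq0[p0 p0b]; rewrite -lerBlDr.
apply: lb_le_inf; first by exists (completion_dist (completion_embed y) p0), p0.
move=> _ [p pb <-]; rewrite lerBlDr.
apply: (@le_trans _ _ (completion_dist (completion_embed x) p)).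
  by apply: ge_inf; [exact: dists_lb|exists p].
have [u [_ _ lim]] := metric_boundaryP pb.
have lim2 : mdist y (u n) + mdist x y @[n --> \oo] -->
    completion_dist (completion_embed y) p + mdist x y.
  by apply: cvgD => //; exact: cvg_cst.
apply: (ler_cvg_to (lim x) lim2); near=> n.
by rewrite addrC metric_triangle.
Unshelve. all: by end_near. Qed.

Lemma cauchy_cluster_cvg u x : cauchy_seq u -> cluster (u @ \oo) x ->
  u @ \oo --> x.
Proof.
move=> /cauchy_seqP uc ux; apply/metricType_numDomainType.cvgrPdist_lt => e e0.
have e20 : 0 < e / 2 by lra.
have [N hN] := uc _ e20.
have uN : (u @ \oo) [set u n | n in [set n | (N <= n)%N]].
  by exists N => // n nN; exists n.
have [_ [[n nN <-]]] := ux _ _ uN (nbhsx_ballx x _ e20).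
rewrite ballEmdist /= => xn; exists N => // m /= mN.
by have := hN n m nN mN; have := metric_triangle x (u n) (u m); lra.
Qed.

(** A Cauchy sequence that stays in a compact neighbourhood of [x] converges, so
    the distance from [x] to a boundary point is at least the radius of that
    neighbourhood. *)
Lemma boundary_dist_gt0 x : incomplete T -> locally_compact [set: T] ->
  0 < boundary_dist x.
Proof.
move=> inc lc; have [K xK [Kc _]] := lc x I.
have {}xK : nbhs x K by move: xK; rewrite withinET.
move: xK; rewrite -nbhs_ballE => -[r r0 rK].
apply: (@lt_le_trans _ _ r) => //.
have [p0 p0b] := metric_boundary_neq0 inc.
apply: lb_le_inf; first by exists (completion_dist (completion_embed x) p0), p0.
move=> _ [p pb <-]; rewrite leNgt; apply/negP => ltr.
have [u [uc nu lim]] := metric_boundaryP pb.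
have uK : (u @ \oo) K.
  apply: filterS (cvgr_lt _ (lim x) _ ltr) => n xn.
  by apply: rK; rewrite ballEmdist.
have [l [_ ul]] := Kc _ _ uK.
exact: nu l (cauchy_cluster_cvg uc ul).
Qed.

End BoundaryDistance.

(** * Length of curves *)

Lemma path_le_last {R : realType} (x : R) (s : seq R) :
  path <=%R x s -> x <= last x s.
Proof.
rewrite le_path_sortedE => /andP[/allP h _].
by case: s h => [//|y s h]; apply: h; rewrite /= mem_last.
Qed.

Lemma path_ltW {R : realType} (x : R) (s : seq R) :
  path <%R x s -> path <=%R x s.
Proof. by apply: sub_path => u v /ltW. Qed.

Section ArcLength.
Context {R : realType} {T : metricType R}.
Implicit Types (g : R -> T) (a b c t x y e : R) (s : seq R).

(** Recursion on the list replaces the indexed sum in [polygonal_length]. *)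
Fixpoint polygon g x s : R :=
  if s is y :: s' then mdist (g x) (g y) + polygon g y s' else 0.

Local Notation len g a b := (curve_length a b g).

Lemma polygonal_lengthE a b g s : polygonal_length a b g s = polygon g a s.
Proof.
rewrite /polygonal_length; elim: s a => [|y s IH] a; first by rewrite big_nil.
by rewrite [size _]/= big_nat_recl //= -IH.
Qed.

Lemma polygon_cat g x s s' :
  polygon g x (s ++ s') = polygon g x s + polygon g (last x s) s'.
Proof.
by elim: s x => [|y s IH] x /=; rewrite ?add0r// IH addrA.
Qed.

Lemma polygon_le_strict a b g s : path <%R a s -> last a s = b ->
  ((polygon g a s)%:E <= len g a b)%E.
Proof.
move=> ps ls; apply: ereal_sup_ubound; exists s; last by rewrite polygonal_lengthE.
by split => //; apply/eqP.
Qed.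

Lemma curve_length_le a b g (l : \bar R) :
  (forall s, path <%R a s -> last a s = b -> ((polygon g a s)%:E <= l)%E) ->
  (len g a b <= l)%E.
Proof.
move=> h; apply: ub_ereal_sup => _ [s [ps /eqP ls] <-].
by rewrite polygonal_lengthE; exact: h.
Qed.

Lemma curve_length_gt a b g (r : R) : (r%:E < len g a b)%E ->
  exists s, [/\ path <%R a s, last a s = b & r < polygon g a s].
Proof.
move=> /ereal_sup_gt[_ [s [ps /eqP ls] <-]]; rewrite polygonal_lengthE lte_fin.
by exists s.
Qed.

Lemma curve_length_ge_dist a b g : a <= b ->
  ((mdist (g a) (g b))%:E <= len g a b)%E.
Proof.
rewrite le_eqVlt => /orP[/eqP <-|ab].
  rewrite mdistxx; exact: (@polygon_le_strict a a g [::]).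
have -> : mdist (g a) (g b) = polygon g a [:: b] by rewrite /= addr0.
by apply: polygon_le_strict => //=; rewrite ab.
Qed.

Lemma curve_length_ge0 a b g : a <= b -> (0%:E <= len g a b)%E.
Proof.
move=> /(curve_length_ge_dist g); apply: le_trans.
by rewrite lee_fin mdist_ge0.
Qed.

Lemma curve_length_superadditive a b c g : a <= b -> b <= c ->
  (len g a b + len g b c <= len g a c)%E.
Proof.
move=> ab bc; have ac := le_trans ab bc.
have cat s s' : path <%R a s -> last a s = b -> path <%R b s' -> last b s' = c ->
    ((polygon g a s + polygon g b s')%:E <= len g a c)%E.
  move=> ps ls ps' ls'; rewrite -{1}ls -polygon_cat.
  by apply: polygon_le_strict; rewrite ?cat_path ?ls ?ps ?last_cat ?ls.
case E : (len g a c) cat => [r| |] cat; last 2 first.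
- exact: leey.
- by have := curve_length_ge0 g ac; rewrite E.
have h2 s : path <%R a s -> last a s = b ->
    (len g b c <= (r - polygon g a s)%:E)%E.
  move=> ps ls; apply: curve_length_le => s' ps' ls'.
  by have := cat s s' ps ls ps' ls'; rewrite !lee_fin; lra.
have := curve_length_ge0 g bc; case E2 : (len g b c) h2 => [q| |]// h2 _.
  have h1 : (len g a b <= (r - q)%:E)%E.
    apply: curve_length_le => s ps ls.
    by have := h2 s ps ls; rewrite !lee_fin; lra.
  move: h1; case: (len g a b) => [p| |]//=; last by rewrite addNye !leNye.
  by rewrite -EFinD !lee_fin; lra.
have h1 : (len g a b <= -oo)%E.
  apply: curve_length_le => s ps ls.
  by have := h2 s ps ls; rewrite leNgt ltry.
by have := le_trans (curve_length_ge0 g ab) h1.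
Qed.

(** Weakly increasing partitions are allowed here, which spares case distinctions
    when a cut point coincides with a vertex. *)
Lemma polygon_le a b g s : path <=%R a s -> last a s = b ->
  ((polygon g a s)%:E <= len g a b)%E.
Proof.
elim: s a => [a _ /= <-|y s IH a /= /andP[ay ps] ls].
  exact: curve_length_ge0.
have yb : y <= b by rewrite -ls; exact: path_le_last.
apply: le_trans (curve_length_superadditive g ay yb).
by rewrite EFinD; apply: leeD; [exact: curve_length_ge_dist|exact: IH].
Qed.

Lemma curve_length_additive a b c g : a <= b -> b <= c ->
  len g a c = (len g a b + len g b c)%E.
Proof.
move=> ab bc; apply/eqP; rewrite eq_le curve_length_superadditive// andbT.
apply: curve_length_le => s.
move=> /path_ltW; elim: s a ab => [a ab _ /= ac|y s IH a ab /= /andP[ay ps] ls].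
  by apply: adde_ge0; exact: curve_length_ge0.
case: (leP b y) => byle.
  apply: (@le_trans _ _ ((polygon g a [:: b])%:E + (polygon g b (y :: s))%:E)%E).
    rewrite -EFinD lee_fin /= addr0 addrA lerD2r; exact: metric_triangle.
  by apply: leeD; apply: polygon_le => //=; rewrite ?ab// byle.
apply: (@le_trans _ _ (len g a y + (len g y b + len g b c))%E).
  by rewrite EFinD; apply: leeD; [exact: curve_length_ge_dist|apply: IH => //; exact: ltW].
rewrite addeA; apply: leeD => //.
by apply: curve_length_superadditive => //; exact: ltW.
Qed.

(** By continuity of [g], cutting the last edge of a nearly optimal polygon just
    before its end loses little length. *)
Lemma curve_length_left_continuous a t g e : a < t -> 0 < e ->
  (len g a t < +oo)%E ->
  (forall e, 0 < e -> exists2 r, 0 < r &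
     forall t', a <= t' -> t - r < t' -> t' <= t -> mdist (g t') (g t) < e) ->
  exists2 t', a <= t' < t & (len g a t <= len g a t' + e%:E)%E.
Proof.
move=> at_ e0 fin cont; have e20 : 0 < e / 2 by lra.
have := curve_length_ge0 g (ltW at_); case E : (len g a t) fin => [l| |]// _ _.
have [s [ps ls lp]] : exists s,
    [/\ path <%R a s, last a s = t & l - e / 2 < polygon g a s].
  by apply: curve_length_gt; rewrite E lte_fin; lra.
have [r r0 hr] := cont _ e20.
case/lastP: s ps ls lp => [|s z]; first by move=> _ /= ta; move: at_; rewrite ta ltxx.
rewrite rcons_path last_rcons -cats1 polygon_cat /= addr0 => /andP[ps +] zt.
rewrite zt; set x := last a s => xt lp.
have ax : a <= x by exact/path_le_last/path_ltW.
pose t' := Num.max x (t - r / 2).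
have [xt' rt' t't] : [/\ x <= t', t - r < t' & t' < t].
  by rewrite /t' le_max lexx lt_max gt_max xt; split => //; [apply/orP; right|]; lra.
have at' : a <= t' by exact: le_trans xt'.
exists t'; first by rewrite at'.
have := hr t' at' rt' (ltW t't) => gt't.
have lt' : ((polygon g a (rcons s t'))%:E <= len g a t')%E.
  apply: polygon_le; last by rewrite last_rcons.
  by rewrite rcons_path xt' andbT; exact: path_ltW.
move: lt'; rewrite -cats1 polygon_cat /= addr0 -/x => lt'.
apply: (@le_trans _ _ ((polygon g a s + mdist (g x) (g t'))%:E + e%:E)%E); last first.
  by rewrite leeD2r.
rewrite -EFinD lee_fin; have := metric_triangle (g x) (g t') (g t); lra.
Qed.

Lemma curve_length_right_continuous t b g e : t < b -> 0 < e ->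
  (len g t b < +oo)%E ->
  (forall e, 0 < e -> exists2 r, 0 < r &
     forall t', t' <= b -> t' < t + r -> t <= t' -> mdist (g t') (g t) < e) ->
  exists2 t', t < t' <= b & (len g t b <= len g t' b + e%:E)%E.
Proof.
move=> tb e0 fin cont; have e20 : 0 < e / 2 by lra.
have := curve_length_ge0 g (ltW tb); case E : (len g t b) fin => [l| |]// _ _.
have [s [ps ls lp]] : exists s,
    [/\ path <%R t s, last t s = b & l - e / 2 < polygon g t s].
  by apply: curve_length_gt; rewrite E lte_fin; lra.
have [r r0 hr] := cont _ e20.
case: s ps ls lp => [|x s]; first by move=> _ /= bt; move: tb; rewrite bt ltxx.
move=> /= /andP[tx ps] ls lp.
have ps' : path <=%R x s by exact: path_ltW.
have xb : x <= b by rewrite -ls; exact: path_le_last.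
pose t' := Num.min x (t + r / 2).
have [xt' rt' t't] : [/\ t' <= x, t' < t + r & t < t'].
  by rewrite /t' ge_min lexx gt_min lt_min tx; split => //; [apply/orP; right|]; lra.
have t'b : t' <= b by exact: le_trans xb.
exists t'; first by rewrite t't.
have := hr t' t'b rt' (ltW t't) => gt't.
have lt' : ((polygon g t' (x :: s))%:E <= len g t' b)%E.
  by apply: polygon_le => //=; rewrite xt'.
apply: (@le_trans _ _ ((polygon g t' (x :: s))%:E + e%:E)%E); last first.
  by rewrite leeD2r.
rewrite -EFinD lee_fin /=; have := metric_triangle (g t) (g t') (g x).
rewrite (metric_sym (g t) (g t')); lra.
Qed.

End ArcLength.

(** * Arc length parametrization *)

Section Reparametrization.
Context {R : realType} {T : metricType R}.

Definition lip1 (h : R -> T) : Prop := forall s t, mdist (h s) (h t) <= `|s - t|.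

Variables (a b : R) (g : R -> T).
Hypothesis ab : a <= b.
Hypothesis g_cont : {within `[a, b], continuous g}.
Hypothesis g_rect : rectifiable a b g.

Local Notation F t := (fine (curve_length a t g)).
Local Notation L := (F b).

Lemma within_continuous_dist t e : a <= t <= b -> 0 < e ->
  exists2 r, 0 < r &
    forall t', a <= t' <= b -> t - r < t' -> t' < t + r -> mdist (g t') (g t) < e.
Proof.
move=> tab e0; have /subspace_continuousP /(_ t) := g_cont.
rewrite /= in_itv /= => /(_ tab) /metricType_numDomainType.cvgrPdist_lt /(_ e e0).
rewrite near_withinE -nbhs_ballE => -[r r0 hr].
exists r => // t' t'ab h1 h2; rewrite metric_sym; apply: hr.
  by rewrite /ball /= ltr_norml; lra.
by rewrite /= in_itv.
Qed.

Lemma curve_length_fin s t : a <= s -> s <= t -> t <= b ->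
  curve_length s t g \is a fin_num.
Proof.
move=> as_ st tb; rewrite ge0_fin_numE ?curve_length_ge0//.
apply: le_lt_trans g_rect.
rewrite (curve_length_additive g as_ (le_trans st tb)) (curve_length_additive g st tb).
apply: le_trans (leeDr _ _); last exact: curve_length_ge0.
by apply: leeDl; exact: curve_length_ge0.
Qed.

Let F_additive s t : a <= s -> s <= t -> t <= b ->
  F t = F s + fine (curve_length s t g).
Proof.
move=> as_ st tb; rewrite (curve_length_additive g as_ st) fineD//.
  by rewrite curve_length_fin// (le_trans st).
exact: curve_length_fin.
Qed.

Lemma curve_length_fun_mono s t : a <= s -> s <= t -> t <= b -> F s <= F t.
Proof.
move=> as_ st tb; rewrite (F_additive as_ st tb) lerDl.
by rewrite fine_ge0// curve_length_ge0.
Qed.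

Lemma curve_length_fun_dist s t : a <= s -> s <= t -> t <= b ->
  mdist (g s) (g t) <= F t - F s.
Proof.
move=> as_ st tb; rewrite (F_additive as_ st tb) addrAC subrr add0r.
rewrite -lee_fin fineK ?curve_length_fin//.
exact: curve_length_ge_dist.
Qed.

Lemma curve_length_fun_start : F a = 0.
Proof.
have := curve_length_additive g (lexx a) (lexx a).
have := curve_length_fin (lexx a) (lexx a) ab.
by case: curve_length => //= r _; rewrite -EFinD => -[]; lra.
Qed.

(** Left continuity of the length from [a], together with additivity and right
    continuity of the length up to [b], excludes jumps: the value is attained at
    the supremum of the times at which the length is at most [s]. *)
Lemma curve_length_fun_onto s : 0 <= s <= L ->
  exists2 t, a <= t <= b & F t = s.
Proof.
move=> /andP[s0 sL].
pose E := [set t | a <= t <= b /\ F t <= s].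
have Ea : E a by rewrite /E /= lexx ab curve_length_fun_start.
have Eb : ubound E b by move=> t [/andP[]].
have supE : has_sup E by split; [exists a|exists b].
pose t := sup E.
have at_ : a <= t by exact: (sup_upper_bound supE).
have tb : t <= b by apply: sup_le_ub => //; exists a.
have tab : a <= t <= b by rewrite at_ tb.
exists t => //; apply/eqP; rewrite eq_le; apply/andP; split.
- have /orP[/eqP <-|a_t] : (a == t) || (a < t) by rewrite -le_eqVlt.
    by rewrite curve_length_fun_start.
  apply/ler_addgt0Pr => e e0.
  have [||t1 /andP[at1 t1t] le1] := @curve_length_left_continuous _ _ a t g e a_t e0.
  + by rewrite -ge0_fin_numE ?curve_length_fin ?curve_length_ge0.
  + move=> e' e'0; have [r r0 hr] := within_continuous_dist tab e'0.
    exists r => // t' at' h1 h2; apply: hr => //; last lra.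
    by rewrite at' (le_trans h2).
  have t1b : t1 <= b by lra.
  have [t2 [/andP[at2 t2b] Ft2] t12] : exists2 t2, E t2 & t1 < t2.
    by apply: sup_gt => //; case: supE.
  apply: (@le_trans _ _ (F t1 + e)); last first.
    by rewrite lerD2r (le_trans _ Ft2)// curve_length_fun_mono// ltW.
  rewrite -lee_fin EFinD !fineK// curve_length_fin//.
- have /orP[/eqP ->//|t_b] : (t == b) || (t < b) by rewrite -le_eqVlt.
  apply/ler_addgt0Pr => e e0.
  have [||t1 /andP[tt1 t1b] le1] := @curve_length_right_continuous _ _ t b g e t_b e0.
  + by rewrite -ge0_fin_numE ?curve_length_fin ?curve_length_ge0.
  + move=> e' e'0; have [r r0 hr] := within_continuous_dist tab e'0.
    exists r => // t' at' h1 h2; apply: hr => //; last lra.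
    by rewrite at' (le_trans at_).
  have at1 : a <= t1 by lra.
  have : s < F t1.
    rewrite ltNge; apply/negP => Ft1.
    have : t1 <= t by apply: (sup_upper_bound supE); rewrite /E /= at1 t1b.
    by rewrite leNgt tt1.
  have := F_additive at_ tb (lexx b); have := F_additive at1 t1b (lexx b).
  move: le1; rewrite -lee_fin.
  rewrite -[curve_length t b g]fineK ?curve_length_fin//.
  rewrite -[curve_length t1 b g]fineK ?curve_length_fin//.
  by rewrite -EFinD !lee_fin; lra.
Qed.

Lemma arclength_paramP s : 0 <= s <= L ->
  exists t, [/\ a <= t <= b, F t = s & arclength_param a b g s = g t].
Proof.
move=> /curve_length_fun_onto[t0 t0ab Ft0].
have [t0a t0b] := andP t0ab.
rewrite /arclength_param.
have lt0 : curve_length a t0 g = s%:E.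
  by rewrite -Ft0 fineK// curve_length_fin.
have [tab ts] := @xgetPex _ a [set t | a <= t <= b /\ curve_length a t g = s%:E]
  (ex_intro _ t0 (conj t0ab lt0)).
by eexists; split; [exact: tab|rewrite ts|].
Qed.

(** A subarc is at least as long as the distance of its ends, so arc length
    parametrizes by a 1-Lipschitz path.  Extending it to the whole line
    by constants makes its composition with a continuous function continuous
    everywhere, not only within a segment. *)
Lemma arclength_reparametrization : exists h : R -> T,
  [/\ lip1 h, forall t, a <= t <= b -> h (F t) = g t &
      forall s, 0 <= s <= L -> h s = arclength_param a b g s].
Proof.
have L0 : 0 <= L by rewrite fine_ge0// curve_length_ge0.
pose clamp s := Num.max 0 (Num.min s L).
have clampE s : 0 <= s <= L -> clamp s = s.
  by move=> /andP[s0 sL]; rewrite /clamp min_l// max_r.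
have clamp_in s : 0 <= clamp s <= L.
  by rewrite /clamp le_max lexx ge_max L0 ge_min lexx orbT.
have clamp_lip s t : `|clamp s - clamp t| <= `|s - t|.
  have cases x : [\/ clamp x = 0 /\ x <= 0, clamp x = x /\ 0 <= x <= L |
      clamp x = L /\ L <= x].
    rewrite /clamp; case: (leP x L) => xL; case: (leP 0 x) => x0.
    - by constructor 2.
    - by constructor 1; split => //; lra.
    - by constructor 3; rewrite max_r//; split => //; lra.
    - by constructor 3; rewrite max_r//; split => //; lra.
  have := ler_norm (s - t); have := ler_norm (t - s); rewrite distrC ler_norml.
  by case: (cases s) => -[-> ?]; case: (cases t) => -[-> ?]; lra.
have dist s t s' t' : a <= t <= b -> F t = s -> a <= t' <= b -> F t' = s' ->
    mdist (g t) (g t') <= `|s - s'|.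
  move=> /andP[at_ tb] <- /andP[at' t'b] <-.
  case: (leP t t') => tt'.
    rewrite distrC; apply: le_trans (ler_norm _); exact: curve_length_fun_dist.
  rewrite metric_sym; apply: le_trans (ler_norm _).
  by apply: curve_length_fun_dist => //; exact: ltW.
exists (fun s => arclength_param a b g (clamp s)); split.
- move=> s s'; apply: le_trans (clamp_lip s s').
  have [t [tab Ft ->]] := arclength_paramP (clamp_in s).
  have [t' [t'ab Ft' ->]] := arclength_paramP (clamp_in s').
  exact: dist.
- move=> t tab; have [at_ tb] := andP tab.
  have FtL : 0 <= F t <= L.
    by rewrite fine_ge0 ?curve_length_ge0// curve_length_fun_mono.
  rewrite clampE//; have [t' [t'ab Ft' ->]] := arclength_paramP FtL.
  apply: mdist_positivity; apply/eqP; rewrite eq_le mdist_ge0 andbT.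
  by apply: le_trans (dist _ _ _ _ t'ab Ft' tab erefl) _; rewrite subrr normr0.
- by move=> s sL; rewrite clampE.
Qed.

End Reparametrization.

(** * Integrals of continuous functions over segments *)

Section Integrals.
Context {R : realType}.
Implicit Types (f : R -> R) (p q r s t m : R).

Local Notation mu := (@lebesgue_measure R).

Definition segint f p q : R := \int[mu]_(x in `[p, q]) f x.

Lemma continuous_segment_integrable f p q : continuous f ->
  mu.-integrable `[p, q] (EFin \o f).
Proof.
move=> cf; apply: continuous_compact_integrable; first exact: segment_compact.
exact: continuous_subspaceT.
Qed.

Lemma segintE f p q : continuous f ->
  (\int[mu]_(x in `[p, q]) (f x)%:E)%E = (segint f p q)%:E.
Proof.
move=> cf; rewrite /segint /Rintegral fineK//.
by apply: integrable_fin_num => //; exact: continuous_segment_integrable.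
Qed.

Lemma segint_add f p q r : continuous f -> p <= q -> q <= r ->
  segint f p r = segint f p q + segint f q r.
Proof.
move=> cf pq qr; have int := continuous_segment_integrable _ _ cf.
have := @Rintegral_itvB _ f (BLeft p) (BRight r) q (int p r).
rewrite !bnd_simp => /(_ pq qr).
rewrite /segint Rintegral_itv_obnd_cbnd; first by move=> <-; rewrite addrC subrK.
by apply: integrableS (int q r) => //; apply: subset_itvr; rewrite bnd_simp.
Qed.

Lemma segint_cst m p q : p <= q -> segint (fun=> m) p q = m * (q - p).
Proof.
move=> pq; rewrite /segint Rintegral_cst//= lebesgue_measure_itv /= lte_fin.
case: ltP => // qp; have -> : q = p by lra.
by rewrite subrr.
Qed.

Lemma segint_ge f p q m : continuous f -> p <= q ->
  (forall x, p <= x <= q -> m <= f x) -> m * (q - p) <= segint f p q.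
Proof.
move=> cf pq h; rewrite -segint_cst//.
have i1 := continuous_segment_integrable p q cf.
have i2 := continuous_segment_integrable p q (@cst_continuous _ _ m).
by apply: le_Rintegral i2 i1 _ => // x; rewrite /= in_itv /=; exact: h.
Qed.

Lemma segint_le f p q m : continuous f -> p <= q ->
  (forall x, p <= x <= q -> f x <= m) -> segint f p q <= m * (q - p).
Proof.
move=> cf pq h; rewrite -segint_cst//.
have i1 := continuous_segment_integrable p q cf.
have i2 := continuous_segment_integrable p q (@cst_continuous _ _ m).
by apply: le_Rintegral i1 i2 _ => // x; rewrite /= in_itv /=; exact: h.
Qed.

Lemma eq_segint f1 f2 p q : (forall x, p <= x <= q -> f1 x = f2 x) ->
  segint f1 p q = segint f2 p q.
Proof.
move=> h; apply: eq_Rintegral => x; rewrite inE /= in_itv /=; exact: h.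
Qed.

Lemma segint_ge0 f p q : (forall x, 0 <= f x) -> 0 <= segint f p q.
Proof. by move=> f0; apply: Rintegral_ge0 => x _. Qed.

Lemma continuous_delta f t e : continuous f -> 0 < e ->
  exists2 r, 0 < r & forall x, t - r < x -> x < t + r -> `|f x - f t| < e.
Proof.
move=> cf e0; have /cvgrPdist_lt /(_ e e0) := cf t.
rewrite -nbhs_ballE => -[r r0 hr]; exists r => // x h1 h2.
by rewrite distrC; apply: hr; rewrite /ball /= ltr_norml; lra.
Qed.

(** Fix [e], and let [s] be the supremum of the times at which [D] has lost at
    most [e] per unit of time.  The condition at [s], applied to intervals that
    contain [s], shows that [s] is such a time, and so are slightly later times
    unless [s = q]. *)
Lemma straddle_nondecreasing (D : R -> R) p q : p <= q ->
  (forall t e, p <= t <= q -> 0 < e -> exists2 r, 0 < r &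
     forall t1 t2, p <= t1 -> t1 <= t -> t <= t2 -> t2 <= q ->
       t - r < t1 -> t2 < t + r -> - e * (t2 - t1) <= D t2 - D t1) ->
  D p <= D q.
Proof.
move=> pq loc; apply/ler_addgt0Pr => e0 e00.
have [e e_gt0 ele] : exists2 e, 0 < e & e * (q - p) <= e0.
  exists (e0 / (q - p + 1)); first by rewrite divr_gt0//; lra.
  by rewrite mulrAC ler_pdivrMr; [nra|lra].
pose E := [set t | p <= t <= q /\ D p - e * (t - p) <= D t].
have Ep : E p by rewrite /E /= lexx pq subrr mulr0 subr0.
have supE : has_sup E by split; [exists p|exists q => t [/andP[]]].
pose s := sup E.
have ps : p <= s by exact: (sup_upper_bound supE).
have sq : s <= q by apply: ge_sup => [|t [/andP[]]//]; exists p.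
have [|r r0 hr] := loc s e _ e_gt0; first by rewrite ps.
have [t1 [/andP[pt1 t1q] Et1] st1] := sup_adherent r0 supE.
have t1s : t1 <= s by apply: (sup_upper_bound supE); split=> //; rewrite pt1.
have ext t2 : s <= t2 -> t2 <= q -> t2 < s + r -> D p - e * (t2 - p) <= D t2.
  by move=> h1 h2 h3; have := hr t1 t2 pt1 t1s h1 h2 st1 h3; nra.
have sqE : s = q.
  apply/eqP; rewrite eq_le sq /= leNgt; apply/negP => s_q.
  pose t2 := Num.min q (s + r / 2).
  have [h1 h2 h3] : [/\ t2 <= q, s < t2 & t2 < s + r].
    by rewrite /t2 ge_min lexx lt_min gt_min s_q; split => //; [|apply/orP; right]; lra.
  have : t2 <= s.
    apply: (sup_upper_bound supE); split; first by rewrite h1 andbT; lra.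
    by apply: ext => //; exact: ltW.
  by rewrite leNgt h2.
have qr : q < s + r by lra.
by have := ext q sq (lexx q) qr; lra.
Qed.

(** The integral is the least interval function that dominates lower Riemann
    sums.  This replaces the change of variables formula for reparametrizations
    that are merely Lipschitz. *)
Lemma segint_min f (Phi : R -> R) p q : continuous f -> p <= q ->
  (forall s t m, p <= s -> s <= t -> t <= q ->
     (forall x, s <= x <= t -> m <= f x) -> m * (t - s) <= Phi t - Phi s) ->
  segint f p q <= Phi q - Phi p.
Proof.
move=> cf pq low.
have seg0 : segint f p p = 0.
  by have := segint_add cf (lexx p) (lexx p); lra.
suff : Phi p - segint f p p <= Phi q - segint f p q by rewrite seg0; lra.
apply: (@straddle_nondecreasing (fun t => Phi t - segint f p t) p q pq).
move=> t e /andP[pt tq] e0; have e20 : 0 < e / 2 by lra.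
have [r r0 hr] := continuous_delta t cf e20.
exists r => // t1 t2 pt1 t1t tt2 t2q h1 h2.
have t12 := le_trans t1t tt2.
have near_t x : t1 <= x <= t2 -> f t - e / 2 <= f x <= f t + e / 2.
  move=> /andP[xt1 xt2]; have := hr x; rewrite ltr_norml => h.
  have {h} := h (lt_le_trans h1 xt1) (le_lt_trans xt2 h2); lra.
have lo := low t1 t2 (f t - e / 2) pt1 t12 t2q (fun x hx => (andP (near_t x hx)).1).
have up := segint_le cf t12 (fun x hx => (andP (near_t x hx)).2).
by have := segint_add cf pt1 t12; nra.
Qed.

Lemma segint_shift f c p q : continuous f -> p <= q ->
  segint (fun t => f (t + c)) p q <= segint f (p + c) (q + c).
Proof.
move=> cf pq; pose Phi t := segint f (p + c) (t + c).
have -> : segint f (p + c) (q + c) = Phi q - Phi p.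
  have := segint_add cf (lexx (p + c)) (lexx (p + c)); rewrite /Phi; lra.
apply: segint_min => //.
  by move=> t; apply: continuous_comp; [apply: cvgD; [exact: cvg_id|exact: cvg_cst]|exact: cf].
move=> s t m ps st tq h.
rewrite /Phi (@segint_add f (p + c) (s + c) (t + c))// ?lerD2r// addrAC subrr add0r.
have -> : t - s = t + c - (s + c) by lra.
apply: segint_ge => //; first by rewrite lerD2r.
by move=> x hx; have := h (x - c); rewrite subrK; apply; lra.
Qed.

Lemma segint_opp f p q : continuous f -> p <= q ->
  segint (fun t => f (- t)) (- q) (- p) <= segint f p q.
Proof.
move=> cf pq; pose Phi t := - segint f p (- t).
have -> : segint f p q = Phi (- p) - Phi (- q).
  have := segint_add cf (lexx p) (lexx p); rewrite /Phi !opprK; lra.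
apply: segint_min; [|lra|].
  by move=> t; apply: continuous_comp; [exact: opp_continuous|exact: cf].
move=> s t m ps st tq h.
have [pt ts] : p <= - t /\ - t <= - s by lra.
have eqS := segint_add cf pt ts.
suff : m * (- s - - t) <= segint f (- t) (- s).
  by rewrite /Phi; lra.
apply: segint_ge => //.
by move=> x hx; have := h (- x); rewrite opprK; apply; lra.
Qed.

End Integrals.

(** * The quasihyperbolic metric *)

Section QuasiHyperbolic.
Context {R : realType} {T : metricType R}.
Hypothesis T_lc : locally_compact [set: T].
Hypothesis T_rc : rectifiably_connected T.
Hypothesis T_inc : incomplete T.

Implicit Types (x y z : T) (e p q r s t m : R).

Local Notation dO := (@boundary_dist R T).
Local Notation k := (@qhyp R T).

Definition qh_density (z : T) : R := (dO z)^-1.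

Let dO_gt0 x : 0 < dO x. Proof. exact: boundary_dist_gt0. Qed.

Lemma qh_density_gt0 x : 0 < qh_density x.
Proof. by rewrite invr_gt0. Qed.

Lemma continuous_density_lip1 (h : R -> T) : lip1 h -> continuous (qh_density \o h).
Proof.
move=> hlip t; apply: cvgV; first by rewrite gt_eqF.
apply/cvgrPdist_lt => e e0; near=> s.
apply: (@le_lt_trans _ _ `|t - s|); last first.
  by near: s; apply: cvgr_dist_lt => //; exact: cvg_id.
apply: le_trans (hlip t s); rewrite ler_norml.
have := boundary_dist_lip (h t) (h s) T_inc; have := boundary_dist_lip (h s) (h t) T_inc.
rewrite (metric_sym (h s)); lra.
Unshelve. all: by end_near. Qed.

Lemma lip1_continuous (h : R -> T) : lip1 h -> continuous h.
Proof.
move=> hlip t; apply/metricType_numDomainType.cvgrPdist_lt => e e0; near=> s.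
apply: (le_lt_trans (hlip t s)).
by near: s; apply: cvgr_dist_lt => //; exact: cvg_id.
Unshelve. all: by end_near. Qed.

Lemma curve_length_lip1 (h : R -> T) p q : lip1 h -> p <= q ->
  (curve_length p q h <= (q - p)%:E)%E.
Proof.
move=> hlip pq; apply: curve_length_le => s; rewrite lee_fin.
elim: s p {pq} => [p _ /= <-|y s IH p /= /andP[py ps] ls]; first by rewrite subrr.
have := IH y ps ls; have := hlip p y.
by rewrite distrC gtr0_norm ?subr_gt0//; lra.
Qed.

Let rect_path x y a b g : curve_joining x y a b g -> rectifiable a b g ->
  exists h : R -> T, [/\ lip1 h, h 0 = x, h (fine (curve_length a b g)) = y,
    forall t, a <= t <= b -> h (fine (curve_length a t g)) = g t &
    line_integral qh_density a b g =
      (segint (qh_density \o h) 0 (fine (curve_length a b g)))%:E].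
Proof.
move=> [ab cg gx gy] gr.
have [h [hlip hF hs]] := arclength_reparametrization ab cg gr.
exists h; split => //.
- by rewrite -(curve_length_fun_start ab gr) hF ?lexx.
- by rewrite hF ?lexx ?ab.
rewrite /line_integral -segintE; last exact: continuous_density_lip1.
by apply: eq_integral => s; rewrite inE /= in_itv /= => sL; rewrite hs.
Qed.

Let lengths x y := [set l | exists a b g,
    [/\ curve_joining x y a b g, rectifiable a b g &
        l = line_integral qh_density a b g]].

Let lengths_ge0 x y : (0%:E <= ereal_inf (lengths x y))%E.
Proof.
apply: le_ereal_inf_tmp => _ [a [b [g [gj gr ->]]]].
have [h [_ _ _ _ ->]] := rect_path gj gr.
by rewrite lee_fin segint_ge0// => t; rewrite ltW// qh_density_gt0.
Qed.

Lemma qhyp_ge0 x y : 0 <= k x y.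
Proof. exact/fine_ge0/lengths_ge0. Qed.

Let lengths_fin x y : (ereal_inf (lengths x y) \is a fin_num).
Proof.
have [a [b [g [gj gr]]]] := T_rc x y; have [h [_ _ _ _ hE]] := rect_path gj gr.
rewrite ge0_fin_numE// (@le_lt_trans _ _ (line_integral qh_density a b g))//.
  by apply: ereal_inf_lbound; exists a, b, g.
by rewrite hE ltry.
Qed.

(** A 1-Lipschitz parametrization travels no faster than arc length, hence its
    integral is at least the line integral: a right inverse [tau] of the arc
    length expands distances, so that the integral of the density along [h] up to
    time [tau s] dominates the lower sums in the arc length parameter [s]. *)
Lemma qhyp_le_segint (h : R -> T) p q : lip1 h -> p <= q ->
  k (h p) (h q) <= segint (qh_density \o h) p q.
Proof.
move=> hlip pq.
have hj : curve_joining (h p) (h q) p q h.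
  by split => //; apply: continuous_subspaceT; exact: lip1_continuous.
have hr : rectifiable p q h by exact: le_lt_trans (curve_length_lip1 hlip pq) (ltry _).
have [H [Hlip _ _ HF HE]] := rect_path hj hr.
set L := fine _ in HE.
have cH := continuous_density_lip1 Hlip; have ch := continuous_density_lip1 hlip.
have pos z : 0 <= qh_density z by rewrite ltW// qh_density_gt0.
have [_ cont _ _] := hj.
have L0 : 0 <= L by rewrite fine_ge0// curve_length_ge0.
rewrite -lee_fin /qhyp fineK; last exact: lengths_fin.
apply: (@le_trans _ _ (line_integral qh_density p q h)).
  by apply: ereal_inf_lbound; exists p, q, h.
rewrite HE lee_fin.
have [tau tauP] : exists tau : R -> R, forall s, 0 <= s <= L ->
    p <= tau s <= q /\ fine (curve_length p (tau s) h) = s.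
  suff : forall s, exists t, 0 <= s <= L ->
      p <= t <= q /\ fine (curve_length p t h) = s.
    by move/choice => [tau tauP]; exists tau.
  move=> s; case: (pselect (0 <= s <= L)) => [sL|nsL]; last by exists 0.
  by have [t tpq tE] := curve_length_fun_onto pq cont hr sL; exists t.
pose Phi s := segint (qh_density \o h) p (tau s).
have tau_mono s t : 0 <= s -> s <= t -> t <= L -> tau s <= tau t.
  move=> s0 st tL; have [] := @tauP s; first by rewrite s0 (le_trans st).
  have [] := @tauP t; first by rewrite (le_trans s0).
  move=> /andP[pt tq] Et /andP[ps sq] Es; case: (leP (tau s) (tau t)) => // ts.
  have := curve_length_fun_mono hr pt (ltW ts) sq; rewrite Et Es => ts'.
  have st' : s = t by lra.
  by move: ts; rewrite st' ltxx.
apply: (@le_trans _ _ (Phi L - Phi 0)).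
  apply: segint_min => // s t m s0 st tL low.
  have tst := tau_mono s t s0 st tL.
  have [] := @tauP s; first by rewrite s0 (le_trans st).
  have [] := @tauP t; first by rewrite (le_trans s0).
  move=> /andP[pt tq] Et /andP[ps sq] Es.
  rewrite /Phi (segint_add ch ps tst) addrAC subrr add0r.
  case: (leP m 0) => m0.
    apply: (@le_trans _ _ 0); first nra.
    by apply: segint_ge0 => ?; exact: pos.
  apply: (@le_trans _ _ (m * (tau t - tau s))).
    apply: ler_wpM2l; first exact: ltW.
    have := curve_length_lip1 hlip tst.
    have := curve_length_additive h ps tst.
    rewrite -[curve_length p (tau t) h]fineK ?(curve_length_fin hr)//.
    rewrite -[curve_length p (tau s) h]fineK ?(curve_length_fin hr)//.
    rewrite -[curve_length (tau s) _ h]fineK ?(curve_length_fin hr)//.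
    by rewrite -EFinD Et Es => -[tE]; rewrite lee_fin; lra.
  apply: segint_ge => // x /andP[x1 x2] /=.
  have px := le_trans ps x1; have xq := le_trans x2 tq.
  rewrite -(HF x); last by rewrite px.
  apply: low; rewrite -{1}Es -Et.
  by rewrite !(curve_length_fun_mono hr).
have [/andP[p0 q0] E0] : p <= tau 0 <= q /\ fine (curve_length p (tau 0) h) = 0.
  by apply: tauP; rewrite lexx.
have [/andP[pL qL] EL] : p <= tau L <= q /\ fine (curve_length p (tau L) h) = L.
  by apply: tauP; rewrite lexx L0.
rewrite /Phi (segint_add ch pL qL).
have : 0 <= segint (qh_density \o h) p (tau 0) by apply: segint_ge0 => ?; exact: pos.
have : 0 <= segint (qh_density \o h) (tau L) q by apply: segint_ge0 => ?; exact: pos.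
lra.
Qed.

Lemma qhyp_path x y (e : R) : 0 < e -> exists (h : R -> T) (q : R),
  [/\ lip1 h, 0 <= q, h 0 = x, h q = y &
      segint (qh_density \o h) 0 q < k x y + e].
Proof.
move=> e0; have : (ereal_inf (lengths x y) < (k x y + e)%:E)%E.
  have -> : ereal_inf (lengths x y) = (k x y)%:E.
    by rewrite /qhyp fineK//; exact: lengths_fin.
  by rewrite lte_fin ltrDl.
move=> /ereal_inf_lt[_ [a [b [g [gj gr ->]]]]].
have [h [hlip h0 hL _ ->]] := rect_path gj gr; rewrite lte_fin => lt_e.
exists h, (fine (curve_length a b g)); split => //.
by case: gj => ab _ _ _; rewrite fine_ge0// curve_length_ge0.
Qed.

(** A curve of length at most [c] from [x] stays in the ball of radius [c]. *)
Lemma qhyp_le_length x y a b g m (c : R) : curve_joining x y a b g ->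
  (curve_length a b g <= c%:E)%E -> 0 < m ->
  (forall z, mdist x z <= c -> m <= dO z) -> k x y <= c / m.
Proof.
move=> gj gc m0 hm.
have gr : rectifiable a b g by exact: le_lt_trans gc (ltry _).
have [h [hlip h0 hL _ _]] := rect_path gj gr.
have [ab _ _ _] := gj.
set L := fine _ in hL.
have L0 : 0 <= L by rewrite fine_ge0// curve_length_ge0.
have Lc : L <= c.
  by rewrite -lee_fin fineK// ge0_fin_numE// curve_length_ge0.
rewrite -h0 -hL; apply: (le_trans (qhyp_le_segint hlip L0)).
apply: (@le_trans _ _ (m^-1 * (L - 0))).
  apply: segint_le => //; first exact: continuous_density_lip1.
  move=> s /andP[s0 sL] /=; rewrite lef_pV2 ?posrE//; apply: hm.
  by rewrite -h0; apply: (le_trans (hlip 0 s)); rewrite sub0r normrN ger0_norm//; lra.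
by rewrite subr0 mulrC ler_pM2r ?invr_gt0.
Qed.

Lemma qhyp_sym_le x y : k x y <= k y x.
Proof.
apply/ler_addgt0Pr => e e0; have [h [q [hlip q0 h0 hq lt_e]]] := qhyp_path y x e0.
have hlip' : lip1 (fun t => h (- t)).
  by move=> s t; apply: (le_trans (hlip _ _)); rewrite -opprD normrN.
have nq : - q <= - 0 by lra.
have := qhyp_le_segint hlip' nq; rewrite /= !opprK h0 hq => le1.
apply: (le_trans le1).
by apply: (le_trans (segint_opp (continuous_density_lip1 hlip) q0)); exact: ltW.
Qed.

Lemma qhyp_sym x y : k x y = k y x.
Proof. by apply/eqP; rewrite eq_le !qhyp_sym_le. Qed.

Lemma qhyp_xx x : k x x = 0.
Proof.
apply/eqP; rewrite eq_le qhyp_ge0 andbT.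
have lc : lip1 (fun _ : R => x) by move=> s t; rewrite mdistxx.
have := qhyp_le_segint lc (lexx 0).
by have := segint_add (continuous_density_lip1 lc) (lexx 0) (lexx 0); lra.
Qed.

(** Concatenation: the second path is translated to start where the first ends,
    and its integral is compared by [segint_shift]. *)
Lemma qhyp_triangle y x z : k x z <= k x y + k y z.
Proof.
apply/ler_addgt0Pr => e e0; have e20 : 0 < e / 2 by lra.
have [h1 [p [lip_1 p0 h10 h1p lt1]]] := qhyp_path x y e20.
have [h2 [q [lip_2 q0 h20 h2q lt2]]] := qhyp_path y z e20.
pose h t := if t <= p then h1 t else h2 (t - p).
have hlip : lip1 h.
  have cross s t : s <= p -> p <= t -> mdist (h1 s) (h2 (t - p)) <= `|s - t|.
    move=> sp pt; apply: (le_trans (metric_triangle _ y _)).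
    have -> : `|s - t| = `|s - p| + `|0 - (t - p)|.
      by rewrite !ler0_norm ?subr_le0 ?subr_ge0 ?(le_trans sp pt)//; ring.
    by rewrite -{1}h1p -h20; exact: lerD.
  move=> s t; rewrite /h; case: (leP s p) => sp; case: (leP t p) => tp.
  - exact: lip_1.
  - by apply: cross => //; exact: ltW.
  - by rewrite metric_sym distrC; apply: cross => //; exact: ltW.
  - by apply: (le_trans (lip_2 _ _)); rewrite opprB addrA subrK.
have hpq : h (p + q) = z.
  rewrite /h; case: leP => hp; last by rewrite addrAC subrr add0r.
  have q00 : q = 0 by apply/le_anti; rewrite q0 andbT -(lerD2l p) addr0.
  by rewrite -h2q q00 addr0 h1p h20.
have h0 : h 0 = x by rewrite /h p0.
have ppq : p <= p + q by rewrite lerDl.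
have := qhyp_le_segint hlip (addr_ge0 p0 q0); rewrite h0 hpq => le1.
apply: (le_trans le1); rewrite (segint_add (continuous_density_lip1 hlip) p0 ppq).
have -> : segint (qh_density \o h) 0 p = segint (qh_density \o h1) 0 p.
  by apply: eq_segint => s /andP[_ sp]; rewrite /= /h sp.
have -> : segint (qh_density \o h) p (p + q) =
    segint (fun t => (qh_density \o h2) (t - p)) p (p + q).
  apply: eq_segint => s /andP[ps _]; rewrite /= /h; case: leP => // sp.
  have -> : s = p by apply/le_anti; rewrite sp ps.
  by rewrite h1p subrr h20.
have := segint_shift (- p) (continuous_density_lip1 lip_2) ppq.
rewrite subrr (addrC p) addrK => le2.
apply: (le_trans (lerD (ltW lt1) (le_trans le2 (ltW lt2)))).
by rewrite addrACA -splitr.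
Qed.

(** A nearly minimizing path is cut where the accumulated integral equals [t]. *)
Lemma qhyp_intermediate x y t e : 0 <= t <= k x y -> 0 < e ->
  exists z, k x z <= t /\ k z y <= k x y - t + e.
Proof.
move=> /andP[t0 tk] e0; have [h [q [hlip q0 h0 hq lt_e]]] := qhyp_path x y e0.
have ch := continuous_density_lip1 hlip.
have pos s : 0 <= (qh_density \o h) s by rewrite ltW// qh_density_gt0.
have seg0 : segint (qh_density \o h) 0 0 = 0.
  by have := segint_add ch (lexx 0) (lexx 0); lra.
have [s /andP[s0 sq] sE] : exists2 s, 0 <= s <= q & segint (qh_density \o h) 0 s = t.
  have cint := parameterized_integral_continuous q0
    (continuous_segment_integrable 0 q ch).
  have [|s] := @IVT _ (segint (qh_density \o h) 0) 0 q t q0 cint.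
    rewrite seg0 ge_min t0 le_max; apply/orP; right.
    by apply: (le_trans tk); rewrite -h0 -hq; exact: qhyp_le_segint.
  by rewrite in_itv /=; exists s.
exists (h s); rewrite -{1}h0 -hq; split.
  by rewrite -sE; exact: qhyp_le_segint.
apply: (le_trans (qhyp_le_segint hlip sq)).
by have := segint_add ch s0 sq; rewrite hq; lra.
Qed.

End QuasiHyperbolic.

(** * Volume packing in small quasihyperbolic balls *)

Lemma pigeonhole_lt (f : nat -> nat) (N : nat) :
  (forall i, (i < N.+1)%N -> (f i < N)%N) ->
  exists i j, (i < j < N.+1)%N /\ f i = f j.
Proof.
move=> fN; apply: contrapT => ninj.
suff /uniq_leq_size : uniq [seq f i | i <- iota 0 N.+1].
  move=> /(_ (iota 0 N)) h; move: h; rewrite size_map !size_iota ltnn => h.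
  suff : false by [].
  by apply: h => _ /mapP[i + ->]; rewrite !mem_iota !add0n /=; exact: fN.
rewrite map_inj_in_uniq ?iota_uniq// => i j; rewrite !mem_iota !add0n /= => iN jN fij.
apply: contrapT => nij; apply: ninj.
by case: (ltngtP i j) => [ij|ji|//]; [exists i, j; rewrite ij|exists j, i; rewrite ji].
Qed.

Section Packing.
Context {R : realType} {T : pointedMetricType R}.
Hypothesis T_lc : locally_compact [set: T].
Hypothesis T_rc : rectifiably_connected T.
Hypothesis T_inc : incomplete T.
Implicit Types (x y z : T).

Local Notation dO := (@boundary_dist R T).
Local Notation k := (@qhyp R T).

Let dO_gt0 x : 0 < dO x. Proof. exact: boundary_dist_gt0. Qed.

(** Along the initial piece of length [theta * dO x] of a path from [x], the
    distance to the boundary is at most [(1 + theta) * dO x], so a path that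
    travels that far has integral at least [theta / (1 + theta)]. *)
Lemma qhyp_lt_mdist x y (theta : R) : 0 < theta ->
  k x y < theta / (1 + theta) -> mdist x y < theta * dO x.
Proof.
move=> th0 lt_k; rewrite ltNge; apply/negP => le_d.
have e0 : 0 < theta / (1 + theta) - k x y by lra.
have [h [q [hlip q0 h0 hq]]] := qhyp_path T_lc T_rc T_inc x y e0.
rewrite addrC subrK => lt_e; have D0 := dO_gt0 x.
have thD : 0 <= theta * dO x by rewrite mulr_ge0// ltW.
have thq : theta * dO x <= q.
  by apply: (le_trans le_d); rewrite -h0 -hq (le_trans (hlip 0 q))// sub0r normrN ger0_norm.
have ch := continuous_density_lip1 T_lc T_inc hlip.
have : theta / (1 + theta) <= segint (@qh_density R T \o h) 0 q.
  rewrite (segint_add ch thD thq).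
  apply: (@le_trans _ _ (segint (@qh_density R T \o h) 0 (theta * dO x))); last first.
    by rewrite lerDl segint_ge0// => t; rewrite ltW// qh_density_gt0.
  apply: (@le_trans _ _ (((1 + theta) * dO x)^-1 * (theta * dO x - 0))).
    rewrite le_eqVlt; apply/orP; left; apply/eqP; field.
    by rewrite !gt_eqF//; lra.
  apply: segint_ge => // t /andP[t0 tth] /=.
  rewrite lef_pV2 ?posrE ?mulr_gt0//; last lra.
  have := boundary_dist_lip (h t) x T_inc; have := hlip t 0.
  by rewrite h0 subr0 (ger0_norm t0); lra.
by rewrite leNgt lt_e.
Qed.

Section Small.
Variables (Q : R) (mu : {measure set (g_sigma_algebraType (@open T)) -> \bar R}).
Variables (C lam c : R).
Hypotheses (C_ge1 : 1 <= C) (c_ge1 : 1 <= c).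
Hypothesis lam_le : 0 < lam <= 2^-1.
Hypothesis quasiconvex : forall x u v : T,
  ball x (lam * dO x) u -> ball x (lam * dO x) v ->
  exists a b g, curve_joining u v a b g /\
    (curve_length a b g <= (c * mdist u v)%:E)%E.
Hypothesis regular : forall (x : T) (r : R), 0 < r <= lam * dO x ->
  ((C^-1 * r `^ Q)%:E <= mu (ball x r) <= (C * r `^ Q)%:E)%E.

Lemma measurable_metric_ball x (r : R) :
  measurable (ball x r : set (g_sigma_algebraType (@open T))).
Proof.
apply: sub_sigma_algebra; rewrite openE => y; rewrite ballEmdist /= => xy.
rewrite /interior -nbhs_ballE; exists (r - mdist x y); first by rewrite /= subr_gt0.
move=> z; rewrite !ballEmdist /=; have := metric_triangle x y z; lra.
Qed.

(** Otherwise the balls of radius [s * dO z] about the points would be disjoint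
    subsets of the ball of radius [lam * dO z] about [z], of too large total
    measure. *)
Lemma ahlfors_packing (s : R) (N : nat) z (y : nat -> T) :
  0 < s -> C ^+ 2 * (lam / s) `^ Q < N%:R ->
  (forall i, (i < N)%N -> s * dO z <= lam * dO (y i)) ->
  (forall i, (i < N)%N -> mdist z (y i) + s * dO z <= lam * dO z) ->
  exists i j, (i < j < N)%N /\ mdist (y i) (y j) < 2 * (s * dO z).
Proof.
move=> s0 big small inside; apply: contrapT => nclose.
have [lam0 _] := andP lam_le; have D0 := dO_gt0 z.
pose F i : set (g_sigma_algebraType (@open T)) :=
  if (i < N)%N then ball (y i) (s * dO z) else set0.
have mF i : measurable (F i).
  by rewrite /F; case: ifP => _; [exact: measurable_metric_ball|exact: measurable0].
have tF : trivIset [set: nat] F.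
  apply/trivIsetP => i j _ _ ij; apply/seteqP; split => // w [].
  rewrite /F; case: ifP => // iN; case: ifP => // jN.
  rewrite !ballEmdist /= => yi yj.
  have yy : mdist (y i) (y j) < 2 * (s * dO z).
    have := metric_triangle (y i) w (y j); rewrite (metric_sym w); lra.
  apply: nclose; case: (ltngtP i j) ij => // [ij|ji] _.
    by exists i, j; rewrite ij.
  by exists j, i; rewrite ji metric_sym.
have sub : (\big[setU/set0]_(i < N) F i `<=` ball z (lam * dO z))%classic.
  rewrite -bigcup_mkord => w [i /= iN]; rewrite /F iN !ballEmdist /= => yw.
  by have := inside i iN; have := metric_triangle z (y i) w; lra.
have := le_measure mu _ _ sub; rewrite !inE => le_mu.
have mU : measurable (\big[setU/set0]_(i < N) F i).
  by apply: bigsetU_measurable => i _; exact: mF.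
have {}le_mu := le_mu mU (measurable_metric_ball z _).
have [|_ up] := andP (regular (x := z) (r := lam * dO z) _).
  by rewrite lexx andbT mulr_gt0.
have low i : (i < N)%N -> ((C^-1 * (s * dO z) `^ Q)%:E <= mu (F i))%E.
  move=> iN; have [|+ _] := andP (regular (x := y i) (r := s * dO z) _).
    by rewrite mulr_gt0// small.
  by rewrite /F iN.
have : ((C^-1 * (s * dO z) `^ Q *+ N)%:E <= (C * (lam * dO z) `^ Q)%:E)%E.
  apply: le_trans up; apply: le_trans le_mu; rewrite measure_bigsetU//.
  have -> : C^-1 * (s * dO z) `^ Q *+ N = \sum_(i < N) (C^-1 * (s * dO z) `^ Q).
    by rewrite sumr_const card_ord.
  by rewrite -sumEFin; apply: lee_sum => i _; exact: low.
have -> : lam * dO z = lam / s * (s * dO z) by field; rewrite gt_eqF.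
rewrite [(lam / s * _) `^ Q]powRM ?divr_ge0 ?mulr_ge0 ?(ltW s0) ?(ltW lam0) ?(ltW D0)//.
rewrite lee_fin -mulr_natr.
have V0 : 0 < (s * dO z) `^ Q by rewrite powR_gt0// mulr_gt0.
move: V0 big; set V := (s * dO z) `^ Q; set W := (lam / s) `^ Q => V0 big.
rewrite leNgt => /negP; apply.
have C0 : 0 < C by exact: lt_le_trans ltr01 C_ge1.
rewrite -(ltr_pM2l C0).
have -> : C * (C * (W * V)) = V * (C ^+ 2 * W) by ring.
have -> : C * (C^-1 * V * N%:R) = V * N%:R by field; rewrite gt_eqF.
by rewrite ltr_pM2l.
Qed.

(** Within [lam / 4 * dO z] of [z], distances to the boundary are comparable with
    [dO z], and quasiconvexity bounds [k] by a multiple of [mdist / dO z].  Hence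
    points that are [k]-separated by [r0] are separated in the metric by a fixed
    fraction [kappa] of [dO z], and [ahlfors_packing] bounds their number. *)
Lemma qhyp_packing_small (r0 : R) : 0 < r0 -> exists N : nat,
  forall z (y : nat -> T),
    (forall i, (i < N)%N -> k z (y i) < lam / 4 / (1 + lam / 4)) ->
    exists i j, (i < j < N)%N /\ k (y i) (y j) <= r0.
Proof.
move=> r00; have [lam0 lam1] := andP lam_le.
pose r := Num.min r0 lam.
have [r_gt0 r_le r_lam] : [/\ 0 < r, r <= r0 & r <= lam].
  by rewrite /r lt_min r00 lam0 !ge_min !lexx orbT.
have c0 : 0 < c by exact: lt_le_trans ltr01 c_ge1.
(* points closer than [kappa * dO z] are at quasihyperbolic distance <= r *)
pose kappa := r / (4 * c).
have kappa_gt0 : 0 < kappa by rewrite divr_gt0// mulr_gt0.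
have kappaE : c * kappa = r / 4 by rewrite /kappa; field; rewrite gt_eqF.
have kappa_le : kappa <= r / 4 by rewrite -kappaE ler_peMl// ltW.
have s0 : 0 < kappa / 2 by lra.
have bnd : 0 <= C ^+ 2 * (lam / (kappa / 2)) `^ Q.
  by rewrite mulr_ge0 ?powR_ge0// exprn_ge0// (le_trans ler01).
exists (Num.bound (C ^+ 2 * (lam / (kappa / 2)) `^ Q)) => z y near_z.
set N := Num.bound _ in near_z *.
have D0 := dO_gt0 z.
have lD : lam * dO z <= dO z / 2 by rewrite mulrC ler_pM2l.
have kD : kappa * dO z <= lam * dO z / 4.
  by rewrite [lam * _ / 4]mulrAC ler_pM2r//; lra.
have lD0 : 0 < lam * dO z by exact: mulr_gt0.
have rD : r * dO z <= lam * dO z by rewrite ler_pM2r.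
have dzy i : (i < N)%N -> mdist z (y i) < lam / 4 * dO z.
  by move=> iN; apply: qhyp_lt_mdist; [lra|exact: near_z].
have dOy i : (i < N)%N -> (1 - lam / 4) * dO z <= dO (y i).
  by move=> iN; have := dzy i iN; have := boundary_dist_lip z (y i) T_inc; lra.
have [||i [j [ij dij]]] := ahlfors_packing s0 (archi_boundP bnd) (y := y) (z := z).
- move=> i iN; have dy : dO z / 2 <= dO (y i) by have := dOy i iN; lra.
  by have := ler_wpM2l (ltW lam0) dy; lra.
- by move=> i iN; have := dzy i iN; lra.
exists i, j; split => //; apply: le_trans r_le.
have jN : (j < N)%N by case/andP: ij.
have iN : (i < N)%N by case/andP: ij => /ltn_trans; apply.
have inball l : (l < N)%N -> ball z (lam * dO z) (y l).
  by move=> lN; rewrite ballEmdist /=; have := dzy l lN; lra.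
have [a [b [g [gj gl]]]] := quasiconvex (inball i iN) (inball j jN).
have cd : c * mdist (y i) (y j) <= r / 4 * dO z.
  by rewrite -kappaE -mulrA ler_pM2l//; lra.
have -> : r = r / 4 * dO z / (dO z / 4) by field; rewrite gt_eqF.
apply: (qhyp_le_length T_lc T_rc T_inc gj).
- by apply: (le_trans gl); rewrite lee_fin.
- by rewrite divr_gt0.
move=> w yw; have := boundary_dist_lip (y i) w T_inc; have := dOy i iN.
lra.
Qed.

End Small.
End Packing.

(** * Packing in all quasihyperbolic balls and conclusion *)

Section Growth.
Context {R : realType} {X : Type}.
Variables (d : X -> X -> R) (r1 : R).
Hypothesis dxx : forall x, d x x = 0.
Hypothesis dsym : forall x y, d x y = d y x.
Hypothesis dtri : forall y x z, d x z <= d x y + d y z.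
Hypothesis dmid : forall x y (t e : R), 0 <= t <= d x y -> 0 < e ->
  exists z, d x z <= t /\ d z y <= d x y - t + e.
Hypothesis r1_gt0 : 0 < r1.
Hypothesis small : forall r0, 0 < r0 -> exists N : nat,
  forall z (y : nat -> X), (forall i, (i < N)%N -> d z (y i) < r1) ->
    exists i j, (i < j < N)%N /\ d (y i) (y j) <= r0.

(** Enlarging the radius by [r1 / 4]: a point of the larger ball is within
    [r1 / 2] of a point of the smaller one, hence within [3 / 4 * r1] of one of
    the given centers, and each ball of radius [r1] is covered anew. *)
Lemma ball_covering (r0 : R) (n : nat) : 0 < r0 -> r0 <= r1 / 4 ->
  exists N : nat, forall z, exists c : nat -> X,
    forall y, d z y <= n%:R * (r1 / 4) -> exists2 i, (i < N)%N & d (c i) y <= r0.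
Proof.
move=> r00 r0_le; have r1_pos := r1_gt0; have [N1 pack1] := small r00.
have cover1 z : exists c : nat -> X,
    forall y, d z y < r1 -> exists2 i, (i < N1)%N & d (c i) y <= r0.
  have Sz : [set y | d z y < r1] z by rewrite /= dxx.
  have [c [_ hc]] := greedy_cover (close := fun y y' => d y y' <= r0) Sz (pack1 z).
  by exists c.
elim: n => [|n [N IH]].
  exists N1 => z; have [c hc] := cover1 z; exists c => y.
  by rewrite mul0r => zy; apply: hc; apply: (le_lt_trans zy).
exists (N * N1)%N => z; have [c hc] := IH z.
have [c' hc'] : exists c' : nat -> nat -> X, forall i y, d (c i) y < r1 ->
    exists2 j, (j < N1)%N & d (c' i j) y <= r0.
  have /choice[c' hc'] : forall i, exists f : nat -> X, forall y, d (c i) y < r1 ->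
      exists2 j, (j < N1)%N & d (f j) y <= r0 by move=> i; exact: cover1.
  by exists c'.
exists (fun m => c' (m %/ N1)%N (m %% N1)%N) => y zy.
suff [i iN ciy] : exists2 i, (i < N)%N & d (c i) y < r1.
  have [j jN1 cij] := hc' i y ciy.
  exists (i * N1 + j)%N.
    by rewrite (@leq_trans (i.+1 * N1))// ?leq_mul2r ?iN ?orbT// mulSn addnC ltn_add2r.
  rewrite divnMDl ?(leq_ltn_trans _ jN1)// divn_small// addn0.
  by rewrite modnMDl modn_small.
pose t := n%:R * (r1 / 4).
have t0 : 0 <= t by rewrite mulr_ge0//; lra.
have zy' : d z y <= t + r1 / 4 by move: zy; rewrite -natr1 mulrDl mul1r.
case: (leP (d z y) t) => [zyt|tzy].
  by have [i iN ciy] := hc y zyt; exists i => //; lra.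
have r40 : 0 < r1 / 4 by lra.
have [|w [zw wy]] := @dmid z y t (r1 / 4) _ r40; first by rewrite t0 ltW.
have [i iN ciw] := hc w zw; exists i => //.
by have := dtri w (c i) y; lra.
Qed.

Lemma bounded_packing (r : R) : exists N, forall y : nat -> X,
  (forall i j, (i < N)%N -> (j < N)%N -> d (y i) (y j) <= r) ->
  exists i j, (i < j < N)%N /\ d (y i) (y j) <= 1.
Proof.
have r1_pos := r1_gt0; pose r0 := Num.min (r1 / 4) (1 / 2).
have [r00 r0_le r0_1] : [/\ 0 < r0, r0 <= r1 / 4 & r0 <= 1 / 2].
  by rewrite /r0 lt_min !ge_min !lexx orbT; split => //; apply/andP; split; lra.
have r40 : 0 < r1 / 4 by lra.
pose n := Num.bound (Num.max r 0 / (r1 / 4)).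
have rn : r <= n%:R * (r1 / 4).
  have /archi_boundP : 0 <= Num.max r 0 / (r1 / 4).
    by rewrite divr_ge0 ?(ltW r40)// le_max lexx orbT.
  rewrite -/n ltr_pdivrMr// => /ltW; apply: le_trans.
  by rewrite le_max lexx.
have [N cover] := ball_covering n r00 r0_le.
exists N.+1 => y yr; have [c hc] := cover (y 0%N).
have [f fP] : exists f : nat -> nat, forall i, (i < N.+1)%N ->
    (f i < N)%N /\ d (c (f i)) (y i) <= r0.
  suff : forall i, exists j, (i < N.+1)%N -> (j < N)%N /\ d (c j) (y i) <= r0.
    by move/choice => [f fP]; exists f.
  move=> i; case: (ltnP i N.+1) => [iN|_]; last by exists 0%N.
  have [j jN cj] := hc (y i) (le_trans (yr 0%N i (ltn0Sn N) iN) rn).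
  by exists j.
have [i [j [ij fij]]] := pigeonhole_lt (fun i iN => (fP i iN).1).
exists i, j; split => //; have /andP[ltij jN] := ij.
have [_ ci] := fP i (ltn_trans ltij jN); have [_ cj] := fP j jN.
rewrite -fij in cj; have := dtri (c (f i)) (y i) (y j).
by rewrite (dsym (y i) (c _)); lra.
Qed.

End Growth.

Theorem corollary1p4 (R : realType) (Q : R) (Omega : pointedMetricType R) :
  0 < Q ->
  abstract_domain Omega ->
  locally_quasiconvex Omega ->
  locally_ahlfors_regular Omega Q ->
  gromov_hyperbolic (@qhyp R Omega) ->
  (forall (delta eps : R) (w : Omega),
     delta_hyperbolic (@qhyp R Omega) delta ->
     bourdon_parameter delta eps ->
     doubling (gromov_boundary (@qhyp R Omega))
              (bourdon_dist (@qhyp R Omega) w eps))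
  /\
  (forall (delta eps : R) (xi : set (nat -> Omega)) (w : Omega),
     delta_hyperbolic (@qhyp R Omega) delta ->
     hamenstadt_parameter delta eps ->
     gromov_boundary (@qhyp R Omega) xi ->
     doubling (punctured_boundary (@qhyp R Omega) xi)
              (hamenstadt_dist (@qhyp R Omega) xi w eps)).
Proof.
move=> _ [lc rc inc] [c [lam1 [c1 lam1_in qc]]] [mu [C [lam2 [C1 lam2_in reg]]]] _.
have kxx := qhyp_xx lc rc inc; have ksym := qhyp_sym lc rc inc.
have ktri := qhyp_triangle lc rc inc.
have kmid := qhyp_intermediate lc rc inc.
pose lam := Num.min lam1 lam2.
have [lam_in lam_1 lam_2] : [/\ 0 < lam <= 2^-1, lam <= lam1 & lam <= lam2].
  have [? ?] := andP lam1_in; have [? ?] := andP lam2_in.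
  by rewrite /lam !ge_min !lexx orbT lt_min; split => //; apply/andP; split; lra.
have lam0 : 0 < lam by case/andP: lam_in.
have D0 (x : Omega) : 0 <= boundary_dist x by exact: ltW (boundary_dist_gt0 x inc lc).
have qc' (x u v : Omega) : ball x (lam * boundary_dist x) u ->
    ball x (lam * boundary_dist x) v -> exists a b g,
    curve_joining u v a b g /\ (curve_length a b g <= (c * mdist u v)%:E)%E.
  have le1 : lam * boundary_dist x <= lam1 * boundary_dist x by rewrite ler_wpM2r.
  by move=> /(le_ball le1) ux /(le_ball le1) vx; exact: qc ux vx.
have reg' (x : Omega) (r : R) : 0 < r <= lam * boundary_dist x ->
    ((C^-1 * r `^ Q)%:E <= mu (ball x r) <= (C * r `^ Q)%:E)%E.
  move=> /andP[r0 r_le]; apply: reg; rewrite r0 (le_trans r_le)//.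
  by rewrite ler_wpM2r.
have r10 : 0 < lam / 4 / (1 + lam / 4) by rewrite divr_gt0//; lra.
have kpack := bounded_packing kxx ksym ktri kmid r10
  (qhyp_packing_small lc rc inc C1 c1 lam_in qc' reg').
have kmid1 (x y : Omega) (t : R) : 0 <= t <= qhyp x y ->
    exists z, qhyp x z <= t /\ qhyp z y <= qhyp x y - t + 1.
  by move=> txy; exact: (kmid x y t 1 txy ltr01).
split=> [delta eps w hyp par|delta eps xi w hyp par xi_bd].
- exact: (bourdon_doubling kxx ksym ktri hyp kmid1 kpack).
- exact: (hamenstadt_doubling kxx ksym ktri hyp kmid1 kpack).
Qed.
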